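(* Suppose that the basic regularity assumptions on $f,\psi_\ell,\phi_\ell$ and the quadratic majorization assumption (both stated in the context) hold, and that $f$ is twice continuously differentiable with constants $\underline\nu,\overline\nu>0$ such that $\underline\nu\,\mathrm{Id}\preceq\nabla^2f(\mathbf{x})\preceq\overline\nu\,\mathrm{Id}$ for all $\mathbf{x}\in\mathcal{H}$. Let $(\mathbf{x}^k)_{k\in\mathbb{N}}$ be a sequence generated by the block-coordinate proximal Newton algorithm CO-NEW-BC-FB described in the context, and suppose that: (a) $\bigcup_{i=0}^{I_k-1}J_i^k=\{1,\dots,L\}$ for all $k$; (b) there is $\bar I\in\mathbb{N}^*$ with $0<I_k\le\bar I$ for all $k$; (c) $\Psi$ is bounded from below and the iterates generated by the algorithm (outer and inner) are bounded; (d) $\Psi$ satisfies the Kurdyka-Łojasiewicz property at every $\mathbf{x}\in\operatorname{dom}\Psi$. Then: (i) $\sum_{k=0}^{+\infty}\|\mathbf{x}^{k+1}-\mathbf{x}^k\|<+\infty$. (ii) $(\mathbf{x}^k)_{k\in\mathbb{N}}$ converges to a critical point $\widehat{\mathbf{x}}$ of $\Psi$, i.e. $0\in\partial\Psi(\widehat{\mathbf{x}})$.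
   Context: Setting. $\mathcal{H}=\mathcal{H}_1\times\dots\times\mathcal{H}_L$ is the direct sum of finite-dimensional real Hilbert spaces, $\mathbf{x}=(x_1,\dots,x_L)$, $\|\mathbf{x}\|^2=\sum_\ell\|x_\ell\|^2$. The objective is $\Psi=f+g$ with $g(\mathbf{x})=\sum_{\ell=1}^L\phi_\ell(\psi_\ell(x_\ell))$. For $J\subseteq\{1,\dots,L\}$, $x_J=(x_\ell)_{\ell\in J}$, $\overline J$ is the complement of $J$, $\nabla_Jf$ is the gradient with respect to the blocks in $J$, and $\nabla^2_{J,J}f$ is the corresponding diagonal sub-block of the Hessian. $\partial$ is the limiting (Mordukhovich) subdifferential (equal to the usual subdifferential for convex functions). Basic regularity assumptions. $f$ is continuously differentiable on $\mathcal H$ and there are $\beta_{\ell,j}>0$ with $\|\nabla_\ell f(\mathbf{x}+(0,\dots,0,v_j,0,\dots,0))-\nabla_\ell f(\mathbf{x})\|\le\beta_{\ell,j}\|v_j\|$ for all $\ell,j$, $\mathbf{x}\in\mathcal{H}$, $v_j\in\mathcal{H}_j$. For each $\ell$: $\psi_\ell:\mathcal{H}_\ell\to[0,+\infty]$ is convex, proper, lower semicontinuous and Lipschitz continuous on its domain; $\phi_\ell:[0,+\infty]\to(-\infty,+\infty]$ is concave, strictly increasing and differentiable on $[0,+\infty)$, with $\phi_\ell'$ locally Lipschitz continuous on its domain. Quadratic majorization assumption. For every $\mathbf{y}\in\mathcal{H}$ and $J\subseteq\{1,\dots,L\}$ there are symmetric operators $A_{\mathbf y,\ell}$ on $\mathcal{H}_\ell$,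 $\ell\in J$, with $a\,\mathrm{Id}\preceq A_{\mathbf y,\ell}\preceq b\,\mathrm{Id}$ for constants $a,b>0$ independent of $\mathbf{y},J$, such that for every $x=(x_\ell)_{\ell\in J}$, $f(x\mid y_{\overline{J}})\le f(\mathbf{y})+\sum_{\ell\in J}\big(\langle x_\ell-y_\ell,\nabla_\ell f(\mathbf{y})\rangle+\tfrac12\langle x_\ell-y_\ell,A_{\mathbf y,\ell}(x_\ell-y_\ell)\rangle\big)$, where $f(x\mid y_{\overline J})$ is the value of $f$ when blocks in $J$ are $x_\ell$ and the others are $y_\ell$. Majorant. Given $\mathbf{x}^k$ with $\psi_\ell(x_\ell^k)<+\infty$ for all $\ell$, let $\lambda_{\ell,k}=\phi'_\ell(\psi_\ell(x^k_\ell))$, $m_k(\mathbf{x})=\sum_{\ell=1}^L\lambda_{\ell,k}\psi_\ell(x_\ell)$, and $\Psi_k(\mathbf{x})=f(\mathbf{x})+\sum_{\ell=1}^L\big[\phi_\ell(\psi_\ell(x_\ell^k))+\lambda_{\ell,k}(\psi_\ell(x_\ell)-\psi_\ell(x_\ell^k))\big]$. Algorithm CO-NEW-BC-FB. Constants $\eta,\mu>0$ are fixed, and $\mathbf{x}^0\in\operatorname{dom}g$ with $\psi_\ell(x_\ell^0)<+\infty$ for all $\ell$. For $k=0,1,\dots$: set $\tilde{\mathbf{x}}^k_0=\mathbf{x}^k$. For $i=0,\dots,I_k-1$, given $J=J_i^k\subseteq\{1,\dots,L\}$, find $\alpha_i^k>0$, $\tilde{\mathbf{x}}_{i+1}^k$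 and $\tilde v_i^k=(\tilde v^k_{i,\ell})_{\ell\in J}$ with $\tilde v^k_{i,\ell}\in\lambda_{\ell,k}\partial\psi_\ell(\tilde x^k_{i+1,\ell})$ for all $\ell\in J$ (i.e. $\tilde v_i^k$ is in the $J$-component of $\partial m_k(\tilde{\mathbf{x}}_{i+1}^k)$) such that $$\tilde x_{i+1,J}^k=\arg\min_{y\in\prod_{\ell\in J}\mathcal{H}_\ell}\ \langle\nabla_Jf(\tilde{\mathbf{x}}_i^k),y-\tilde x_{i,J}^k\rangle+\frac1{2\alpha_i^k}\langle y-\tilde x_{i,J}^k,\nabla^2_{J,J}f(\tilde{\mathbf{x}}_i^k)(y-\tilde x_{i,J}^k)\rangle+\sum_{\ell\in J}\lambda_{\ell,k}\psi_\ell(y_\ell),$$ $\tilde x^k_{i+1,\overline J}=\tilde x^k_{i,\overline J}$, $\ \Psi_k(\tilde{\mathbf{x}}_{i+1}^k)+\eta\|\tilde{\mathbf{x}}_{i+1}^k-\tilde{\mathbf{x}}_i^k\|^2\le\Psi_k(\tilde{\mathbf{x}}_i^k)$, and $\|\nabla_Jf(\tilde{\mathbf{x}}_i^k)+\tilde v_i^k\|\le\mu\sum_{\ell\in J}\|\tilde x_{i+1,\ell}^k-\tilde x_{i,\ell}^k\|$. Then set $\mathbf{x}^{k+1}=\tilde{\mathbf{x}}_{I_k}^k$. Kurdyka-Łojasiewicz (KŁ) property of $\Psi$ at $\tilde{\mathbf{u}}$: there exist $r\in(0,+\infty]$, a neighborhood $U$ of $\tilde{\mathbf{u}}$ and a concave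 continuous $\varphi:[0,r)\to[0,+\infty)$ with $\varphi(0)=0$, $\varphi$ of class $C^1$ on $(0,r)$ and $\varphi'>0$ there, such that for all $\mathbf{u}\in U$ with $\Psi(\tilde{\mathbf{u}})<\Psi(\mathbf{u})<\Psi(\tilde{\mathbf{u}})+r$ one has $\varphi'(\Psi(\mathbf{u})-\Psi(\tilde{\mathbf{u}}))\,\mathrm{dist}(0,\partial\Psi(\mathbf{u}))\ge1$. *)

(* Defs.v *)
From HB Require Import structures.
From mathcomp Require Import all_boot all_order all_algebra.
From mathcomp Require Import all_classical all_reals all_analysis.
From mathcomp Require Import ring lra.

Set Implicit Arguments.
Unset Strict Implicit.
Unset Printing Implicit Defensive.

Import Order.TTheory GRing.Theory Num.Theory.
Import numFieldNormedType.Exports.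

Local Open Scope classical_set_scope.
Local Open Scope ring_scope.

(* Real inner product spaces: the norm of the normed module is the one induced
   by the inner product. *)
HB.mixin Record NormedModule_hasInner (R : realType) V & NormedModule R V := {
  inner : V -> V -> R;
  innerC : forall x y, inner x y = inner y x;
  innerDl : forall x y z, inner (x + y) z = inner x z + inner y z;
  innerZl : forall (a : R) x y, inner (a *: x) y = a * inner x y;
  inner_norm : forall x, inner x x = `|x| ^+ 2
}.

#[short(type="innerType")]
HB.structure Definition InnerSpace (R : realType) :=
  {V of NormedModule_hasInner R V & NormedModule R V}.

(* Finite-dimensional real Hilbert spaces (completeness is automatic). *)
#[short(type="euclideanType")]
HB.structure Definition EuclideanSpace (R : realType) :=
  {V of InnerSpace R V & Vector R V}.

(* The direct sum of Hilbert spaces H_0, ..., H_(L-1). *)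
Definition hsum (R : realType) (L : nat) (V : 'I_L -> euclideanType R) : Type :=
  forall l, V l.

Section HSum.
Context {R : realType} {L : nat} {V : 'I_L -> euclideanType R}.
Implicit Types x y z : hsum V.

HB.instance Definition _ := gen_eqMixin (hsum V).
HB.instance Definition _ := gen_choiceMixin (hsum V).

Let add x y : hsum V := fun l => x l + y l.
Let opp x : hsum V := fun l => - x l.
Let zero : hsum V := fun l => 0.
Let scale (a : R) x : hsum V := fun l => a *: x l.

Let addA : associative add.
Proof. by move=> x y z; apply: functional_extensionality_dep => l; exact: addrA. Qed.
Let addC : commutative add.
Proof. by move=> x y; apply: functional_extensionality_dep => l; exact: addrC. Qed.
Let add0 : left_id zero add.
Proof. by move=> x; apply: functional_extensionality_dep => l; exact: add0r. Qed.
Let addN : left_inverse zero opp add.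
Proof. by move=> x; apply: functional_extensionality_dep => l; exact: addNr. Qed.

HB.instance Definition _ :=
  GRing.isZmodule.Build (hsum V) addA addC add0 addN.

Let scaleA a b x : scale a (scale b x) = scale (a * b) x.
Proof. by apply: functional_extensionality_dep => l; exact: scalerA. Qed.
Let scale1 : left_id 1 scale.
Proof. by move=> x; apply: functional_extensionality_dep => l; exact: scale1r. Qed.
Let scaleDr : right_distributive scale +%R.
Proof. by move=> a x y; apply: functional_extensionality_dep => l; exact: scalerDr. Qed.
Let scaleDl x : {morph scale^~ x : a b / a + b}.
Proof. by move=> a b; apply: functional_extensionality_dep => l; exact: scalerDl. Qed.

HB.instance Definition _ :=
  GRing.Zmodule_isLmodule.Build R (hsum V) scaleA scale1 scaleDr scaleDl.

Definition hsum_inner x y : R := \sum_l inner (x l) (y l).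
Definition hsum_norm x : R := Num.sqrt (\sum_l `|x l| ^+ 2).

Let innerC' x y : hsum_inner x y = hsum_inner y x.
Proof. by apply: eq_bigr => l _; exact: innerC. Qed.
Let innerDl' x y z : hsum_inner (x + y) z = hsum_inner x z + hsum_inner y z.
Proof. by rewrite -big_split; apply: eq_bigr => l _; exact: innerDl. Qed.
Let innerZl' (a : R) x y : hsum_inner (a *: x) y = a * hsum_inner x y.
Proof. by rewrite mulr_sumr; apply: eq_bigr => l _; exact: innerZl. Qed.

Let norm_sqr x : hsum_norm x ^+ 2 = hsum_inner x x.
Proof.
rewrite sqr_sqrtr; last by apply: sumr_ge0 => l _; exact: sqr_ge0.
by apply: eq_bigr => l _; rewrite inner_norm.
Qed.

Let inner_ge0 x : 0 <= hsum_inner x x.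
Proof. by rewrite -norm_sqr sqr_ge0. Qed.

Let norm0_eq0 x : hsum_norm x = 0 -> x = 0.
Proof.
move=> /eqP; rewrite sqrtr_eq0 => h.
have /eqP : \sum_l `|x l| ^+ 2 = 0.
  by apply/le_anti; rewrite h sumr_ge0// => l _; exact: sqr_ge0.
rewrite psumr_eq0 => [/allP h0|l _]; last exact: sqr_ge0.
apply: functional_extensionality_dep => l.
by have := h0 l (mem_index_enum l); rewrite /= sqrf_eq0 normr_eq0 => /eqP.
Qed.

Let inner0 y : hsum_inner 0 y = 0.
Proof. by rewrite -(scale0r (0 : hsum V)) innerZl' mul0r. Qed.

Let cauchy_schwarz x y : hsum_inner x y <= hsum_norm x * hsum_norm y.
Proof.
have [/norm0_eq0 ->|p0] := eqVneq (hsum_norm x) 0.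
  by rewrite inner0 mulr_ge0 ?sqrtr_ge0.
have [/norm0_eq0 ->|q0] := eqVneq (hsum_norm y) 0.
  by rewrite innerC' inner0 mulr_ge0 ?sqrtr_ge0.
have {}p0 : 0 < hsum_norm x by rewrite lt_neqAle eq_sym p0 sqrtr_ge0.
have {}q0 : 0 < hsum_norm y by rewrite lt_neqAle eq_sym q0 sqrtr_ge0.
rewrite -(ler_pM2l (mulr_gt0 p0 q0)).
have := inner_ge0 (hsum_norm y *: x + (- hsum_norm x) *: y).
rewrite innerDl' !innerZl' ![hsum_inner _ (_ + _)]innerC' !innerDl' !innerZl'.
by rewrite (innerC' y x) -!norm_sqr; lra.
Qed.

Let norm_triangle x y : hsum_norm (x + y) <= hsum_norm x + hsum_norm y.
Proof.
rewrite -(@ler_pXn2r _ 2)// ?nnegrE ?addr_ge0 ?sqrtr_ge0//.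
rewrite sqrrD !norm_sqr innerDl' ![hsum_inner _ (_ + _)]innerC' !innerDl'.
by rewrite (innerC' y x); have := cauchy_schwarz x y; lra.
Qed.

Let normZ (a : R) x : hsum_norm (a *: x) = `|a| * hsum_norm x.
Proof.
rewrite /hsum_norm -sqrtr_sqr -sqrtrM ?sqr_ge0// mulr_sumr.
congr Num.sqrt; apply: eq_bigr => l _.
by rewrite [X in `|X|](_ : _ = a *: x l)// normrZ exprMn real_normK ?num_real.
Qed.

HB.instance Definition _ :=
  Lmodule_isNormed.Build R (hsum V) norm_triangle normZ norm0_eq0.

HB.instance Definition _ :=
  @NormedModule_hasInner.Build R (hsum V) hsum_inner innerC' innerDl' innerZl'
    (fun x => esym (norm_sqr x)).

(* The point with blocks x_l for l in J and y_l for l outside J. *)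
Definition block_merge (J : {set 'I_L}) x y : hsum V :=
  fun l => if l \in J then x l else y l.

Definition block_restr (J : {set 'I_L}) x : hsum V := block_merge J x 0.

End HSum.

Section Calculus.
Context {R : realType}.

(* Riesz representative of the Fréchet differential 'd f x (it exists and is
   unique when f is differentiable at x, in finite dimension). *)
Definition grad (H : innerType R) (f : H -> R) (x : H) : H :=
  xget 0 [set u | forall h, 'd f x h = inner u h].

(* The Hessian as an operator: the Fréchet differential of the gradient. *)
Definition hess (H : innerType R) (f : H -> R) (x : H) : H -> H :=
  'd (grad f) x.

Definition C1 (H : innerType R) (f : H -> R) : Prop :=
  (forall x, differentiable f x) /\ continuous (grad f).

(* In finite dimension, continuity of x |-> hess f x in operator norm is
   continuity of x |-> hess f x h for every h. *)
Definition C2 (H : innerType R) (f : H -> R) : Prop :=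
  [/\ C1 f, forall x, differentiable (grad f) x
    & forall h, continuous (fun x => hess f x h)].

Local Open Scope ereal_scope.

Definition dom_ereal (T : Type) (h : T -> \bar R) : set T := [set x | h x < +oo].

Definition proper_ereal (T : Type) (h : T -> \bar R) : Prop :=
  (forall x, -oo < h x) /\ dom_ereal h !=set0.

Definition convex_ereal (H : lmodType R) (h : H -> \bar R) : Prop :=
  forall (x y : H) (t : R), (0 <= t <= 1)%R ->
    h (t *: x + (1 - t) *: y)%R <= t%:E * h x + (1 - t)%:E * h y.

(* u is a Fréchet subgradient of h at x: h x is finite and
   liminf_(y -> x, y != x) (h y - h x - <u, y - x>) / |y - x| >= 0. *)
Definition frechet_subdiff (H : innerType R) (h : H -> \bar R) (x : H) : set H :=
  [set u | h x \is a fin_num /\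
    forall e : R, (0 < e)%R -> \forall y \near x,
      h x + (inner u (y - x) - e * `|y - x|)%:E <= h y].

(* Limiting (Mordukhovich) subdifferential. *)
Definition limiting_subdiff (H : innerType R) (h : H -> \bar R) (x : H) : set H :=
  [set u | h x \is a fin_num /\ exists (y v : nat -> H),
    [/\ y @ \oo --> x, h \o y @ \oo --> h x,
        forall n, frechet_subdiff h (y n) (v n) & v @ \oo --> u]].

(* dist(0, A), equal to +oo when A is empty. *)
Definition dist0 (H : innerType R) (A : set H) : \bar R :=
  ereal_inf [set `|v|%:E | v in A].

Definition KL_at (H : innerType R) (Psi : H -> \bar R) (xt : H) : Prop :=
  exists (r : \bar R) (U : set H) (w : R -> R),
    let D0r := [set t : R | (0 <= t)%R /\ t%:E < r] in
    0 < r /\ nbhs xt U /\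
    [/\ (forall t, D0r t -> 0 <= w t)%R, w 0%R = 0%R,
        {within D0r, continuous w}
      & forall s t a : R, D0r s -> D0r t -> (0 <= a <= 1)%R ->
          (a * w s + (1 - a) * w t <= w (a * s + (1 - a) * t))%R] /\
    (forall t : R, (0 < t)%R -> t%:E < r ->
      [/\ derivable w t 1%R, {for t, continuous w^`()%classic}
        & (0 < w^`()%classic t)%R]) /\
    forall u, U u -> Psi xt < Psi u -> Psi u < Psi xt + r ->
      1 <= (w^`()%classic (fine (Psi u - Psi xt)))%:E
             * dist0 (limiting_subdiff Psi u).

(* Difference quotients at t of a function on [0, +oo), restricted to
   increments h != 0 with 0 <= t + h; one-sided at t = 0. *)
Definition slope_nneg (phi : \bar R -> \bar R) (t : R) : set_system R :=
  (fun h => (fine (phi (t + h)%:E) - fine (phi t%:E)) / h)%R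
    @ within [set h | 0 <= t + h]%R 0%R^'.

Definition deriv_nneg (phi : \bar R -> \bar R) (t : R) : R :=
  lim (slope_nneg phi t).

Definition psi_regular (H : innerType R) (psi : H -> \bar R) : Prop :=
  [/\ forall x, 0 <= psi x, convex_ereal psi, proper_ereal psi,
      lower_semicontinuous psi
    & [lipschitz (fine (psi x)) | x in dom_ereal psi]].

(* phi : [0, +oo] -> (-oo, +oo]; its values at negative arguments are
   irrelevant. *)
Definition phi_regular (phi : \bar R -> \bar R) : Prop :=
  [/\ forall t, 0 <= t -> -oo < phi t,
      forall s t (a : R), 0 <= s -> 0 <= t -> (0 <= a <= 1)%R ->
        a%:E * phi s + (1 - a)%:E * phi t <= phi (a%:E * s + (1 - a)%:E * t),
      forall s t, 0 <= s -> s < t -> phi s < phi t,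
      forall t : R, (0 <= t)%R -> phi t%:E \is a fin_num /\
        cvg (slope_nneg phi t)
    & forall t : R, (0 <= t)%R -> exists2 U, nbhs t U &
        [lipschitz (deriv_nneg phi s) | s in U `&` [set s | 0 <= s]%R]].

End Calculus.

Section Problem.
Context {R : realType} {L : nat} {V : 'I_L -> euclideanType R}.
Local Notation H := (hsum V).
Variables (f : H -> R) (psi : forall l, V l -> \bar R)
          (phi : 'I_L -> \bar R -> \bar R).
Local Arguments psi : clear implicits.

(* (0, ..., 0, v_j, 0, ..., 0) is dfwith 0 j v. *)
Definition block_lipschitz_grad : Prop :=
  forall l j, exists2 beta : R, 0 < beta &
    forall (x : H) (v : V j),
      `|grad f (x + (dfwith (0 : H) j v : H)) l - grad f x l| <= beta * `|v|.

Definition quadratic_majorization : Prop :=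
  exists a b : R, [/\ 0 < a, 0 < b &
    forall (y : H) (J : {set 'I_L}), exists A : forall l, {linear V l -> V l},
      (forall l, l \in J ->
        (forall u v, inner (A l u) v = inner u (A l v)) /\
        (forall u, a * `|u| ^+ 2 <= inner u (A l u) <= b * `|u| ^+ 2)) /\
      forall x : H, f (block_merge J x y) <= f y + \sum_(l in J)
        (inner (x l - y l) (grad f y l)
          + 2^-1 * inner (x l - y l) (A l (x l - y l)))].

Definition hess_bounds : Prop :=
  exists nu1 nu2 : R, [/\ 0 < nu1, 0 < nu2 &
    forall x h : H, nu1 * `|h| ^+ 2 <= inner h (hess f x h) <= nu2 * `|h| ^+ 2].

Local Open Scope ereal_scope.

Definition gfun (x : H) : \bar R := \sum_l phi l (psi l (x l)).

Definition Psifun (x : H) : \bar R := (f x)%:E + gfun x.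

Definition lambda (xk : H) (l : 'I_L) : R :=
  deriv_nneg (phi l) (fine (psi l (xk l))).

(* The majorant Psi_k built at xk. *)
Definition majorant (xk x : H) : \bar R :=
  (f x)%:E + \sum_l (phi l (psi l (xk l))
    + (lambda xk l)%:E * (psi l (x l) - psi l (xk l))).

(* Objective of the proximal Newton subproblem; it depends only on the blocks
   y_l with l in J, so that minimizing it over H is minimizing it over
   prod_(l in J) H_l. The quadratic term is the sub-block (J, J) of the Hessian
   at z, applied to (y_l - z_l)_(l in J). *)
Definition newton_model (xk z : H) (J : {set 'I_L}) (alpha : R) (y : H) : \bar R :=
  (\sum_(l in J) inner (grad f z l) (y l - z l)
    + (2 * alpha)^-1 * inner (block_restr J (y - z)) (hess f z (block_restr J (y - z))))%:E
  + \sum_(l in J) (lambda xk l)%:E * psi l (y l).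

(* One inner iteration, from z to z' on the blocks J, with subgradients v. *)
Record inner_step (eta mu : R) (xk : H) (J : {set 'I_L}) (alpha : R)
    (z z' v : H) : Prop := {
  step_size : (0 < alpha)%R;
  step_subgrad : forall l, l \in J ->
    [set lambda xk l *: w | w in limiting_subdiff (psi l) (z' l)]%R (v l);
  step_argmin : forall y : H,
    newton_model xk z J alpha z' <= newton_model xk z J alpha y;
  step_fixed : forall l, l \notin J -> z' l = z l;
  step_descent :
    majorant xk z' + (eta * `|z' - z| ^+ 2)%:E <= majorant xk z;
  step_residual :
    (`|block_restr J (grad f z + v)| <= mu * \sum_(l in J) `|z' l - z l|)%R
}.

(* (x, xt, v) is a run of CO-NEW-BC-FB: x k are the outer iterates, and
   xt k i (0 <= i <= N k) the inner ones, with N k the number I_k of inner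
   iterations. *)
Record CO_NEW_BC_FB (eta mu : R) (N : nat -> nat) (J : nat -> nat -> {set 'I_L})
    (alpha : nat -> nat -> R) (x : nat -> H) (xt v : nat -> nat -> H) : Prop := {
  run_init : gfun (x 0%N) < +oo /\ forall l, psi l (x 0%N l) < +oo;
  run_start : forall k, xt k 0%N = x k;
  run_step : forall k i, (i < N k)%N ->
    inner_step eta mu (x k) (J k i) (alpha k i) (xt k i) (xt k i.+1) (v k i);
  run_next : forall k, x k.+1 = xt k (N k)
}.

End Problem.

(* Main.v *)
Require Import Defs.
From HB Require Import structures.
From mathcomp Require Import all_boot all_order all_algebra.
From mathcomp Require Import all_classical all_reals all_analysis.
From mathcomp Require Import ring lra.

Set Implicit Arguments.
Unset Strict Implicit.
Unset Printing Implicit Defensive.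

Import Order.TTheory GRing.Theory Num.Theory.
Import numFieldNormedType.Exports.

Local Open Scope classical_set_scope.
Local Open Scope ring_scope.

(* Let D_k be the length of the polygonal path of inner iterates from x^k to
   x^(k+1). Concavity of phi_l makes Psi_k a majorant of Psi that touches it at
   x^k, so summing the inner descent inequalities (Cauchy-Schwarz over at most
   Nbar steps) gives Psi(x^(k+1)) + c D_k^2 <= Psi(x^k).

   Each block l is updated for the last time at some inner step j of iteration
   k; the subgradient w_l of psi_l chosen there is still one at x^(k+1), hence
   grad_l f(x^(k+1)) + phi_l'(psi_l(x^(k+1))) w_l is the l-th block of a Frechet
   subgradient of Psi. It differs from the residual of step j by the variations
   of grad f and of phi_l' o psi_l, which are O(D_k); here w_l is bounded because
   lambda w_l is bounded by the residual and lambda is bounded away from 0.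

   These two estimates and the KL inequality at a cluster point of the bounded
   sequence give sum D_k < +oo and convergence to that point. *)

(** * Real analysis *)

(** Concavity gives [a * (g s - g t) <= g (t + a * (s - t)) - g t]; divide by [a] and let [a] tend
    to 0. Differentiability is asked only along the segment from [t] to [s], so that [t] may be an
    endpoint of the domain of [g]. *)
Lemma concave_tangent (R : realType) (g : R -> R) (s t d : R) :
  (forall a : R, 0 <= a <= 1 -> a * g s + (1 - a) * g t <= g (a * s + (1 - a) * t)) ->
  (forall e : R, 0 < e -> exists2 delta : R, 0 < delta & forall a : R, 0 < a <= 1 ->
     a * `|s - t| < delta ->
     `|g (t + a * (s - t)) - g t - d * (a * (s - t))| <= e * (a * `|s - t|)) ->
  g s <= g t + d * (s - t).
Proof.
move=> gconc gder; have [->|st] := eqVneq s t; first by rewrite subrr mulr0 addr0.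
have st0 : 0 < `|s - t| by rewrite normr_gt0 subr_eq0.
suff H (e : R) : 0 < e -> g s <= g t + d * (s - t) + e.
  by rewrite leNgt; apply/negP => h; have := H ((g s - (g t + d * (s - t))) / 2); lra.
move=> e0; have [delta delta0 h] := gder (e / `|s - t|) (divr_gt0 e0 st0).
pose a := Num.min 1 (delta / (2 * `|s - t|)).
have a0 : 0 < a by rewrite lt_min ltr01 divr_gt0// mulr_gt0.
have a1 : a <= 1 by rewrite ge_min lexx.
have ad : a * `|s - t| < delta.
  have : a <= delta / (2 * `|s - t|) by rewrite ge_min lexx orbT.
  rewrite ler_pdivlMr ?mulr_gt0//; lra.
have a01 : 0 < a <= 1 by rewrite a0.
have {h} := h a a01 ad.
have -> : t + a * (s - t) = a * s + (1 - a) * t by ring.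
have := gconc a; rewrite a1 ltW// => /(_ isT).
set G := g (_ + _) => hG.
rewrite [e / _ * _]mulrCA divfK ?gt_eqF// ler_norml => /andP[_ hq].
have : a * (g s - g t) <= a * (d * (s - t) + e) by lra.
by rewrite ler_pM2l//; lra.
Qed.

(** Continuity argument on the supremum [c] of the [t <= T] such that [d] is Lipschitz on [[0, t]]:
    the local constant at [c] carries the property beyond [c], unless [T] is reached. *)
Lemma locally_lipschitz_itv (R : realType) (d : R -> R) (T : R) : 0 <= T ->
  (forall t : R, 0 <= t -> exists2 e : R, 0 < e & exists2 K : R, 0 <= K &
    forall s s' : R, 0 <= s -> 0 <= s' -> `|s - t| < e -> `|s' - t| < e ->
      `|d s - d s'| <= K * `|s - s'|) ->
  exists2 K : R, 0 <= K &
    forall s s' : R, 0 <= s <= T -> 0 <= s' <= T -> `|d s - d s'| <= K * `|s - s'|.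
Proof.
move=> T0 dloc.
pose lip (t K : R) := forall s s' : R, 0 <= s <= t -> 0 <= s' <= t ->
  `|d s - d s'| <= K * `|s - s'|.
pose S := [set t : R | 0 <= t <= T /\ exists2 K : R, 0 <= K & lip t K].
have S0 : S 0.
  split; first by rewrite lexx.
  exists 0 => // s s' /le_anti <- /le_anti <-; by rewrite !subrr normr0 mulr0.
have Sub : has_sup S.
  by split; [exists 0|exists T => t [/andP[]]].
set c := sup S.
have c0 : 0 <= c by apply: (ub_le_sup _ S0); case: Sub.
have cT : c <= T by apply: ge_sup; [exists 0|move=> t [/andP[]]].
have [e e0 [K1 K10 hK1]] := dloc c c0.
have [t [/andP[t0 tT] [K K0 hK]] ct] := sup_adherent e0 Sub; rewrite -/c in ct.
have tc : t <= c by apply: ub_le_sup; [case: Sub|split; [rewrite t0 tT|exists K]].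
pose u := Num.min T (c + e / 2).
have uT : u <= T by rewrite ge_min lexx.
have uc : u <= c + e / 2 by rewrite ge_min lexx orbT.
have tu : t <= u by rewrite le_min tT; lra.
(* A pair on the same side of [t] uses one of the two constants; a pair straddling [t] is split
   there, and both pieces are shorter than the whole. *)
have lipu : lip u (K + K1).
  move=> s s'; wlog ss' : s s' / s <= s'.
    move=> H hs hs'; have [|/ltW] := leP s s'; first by move/H; apply.
    by move=> ss'; rewrite distrC (distrC s); exact: H.
  move=> /andP[s0 su] /andP[s'0 s'u].
  have [s't|ts'] := leP s' t.
    have := hK s s'; rewrite s0 s'0 s't (le_trans ss' s't) => /(_ isT isT) h.
    by apply: (le_trans h); rewrite ler_wpM2r// lerDl.
  have near (v : R) : t <= v -> v <= u -> `|v - c| < e.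
    by move=> h1 h2; rewrite ltr_norml; apply/andP; split; lra.
  have [ts|st] := leP t s.
    apply: le_trans (hK1 s s' s0 s'0 (near _ ts su) (near _ (ltW ts') s'u)) _.
    by rewrite ler_wpM2r// lerDr.
  have h1 : `|d s - d t| <= K * `|s - t|.
    by apply: hK; rewrite ?s0 ?t0 ?lexx ?ltW.
  have h2 : `|d t - d s'| <= K1 * `|t - s'|.
    by apply: hK1 => //; apply: near => //; exact: ltW.
  have h3 : `|s - t| <= `|s - s'| by rewrite !ler0_norm; lra.
  have h4 : `|t - s'| <= `|s - s'| by rewrite !ler0_norm; lra.
  have := ler_distD (d t) (d s) (d s').
  have := ler_wpM2l K0 h3; have := ler_wpM2l K10 h4; lra.
have Su : S u by split; [rewrite uT (le_trans t0 tu)|exists (K + K1) => //; exact: addr_ge0].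
have uc' : u <= c by apply: ub_le_sup => //; case: Sub.
have uE : u = T.
  have [Tc|/ltW cT'] := leP T (c + e / 2); first exact: min_l.
  by move: uc'; rewrite /u min_r// => h; exfalso; lra.
by case: Su => _ [K' K'0]; rewrite uE => h; exists K'.
Qed.

Lemma derive1_expansion (R : realType) (w : R -> R) (t e : R) :
  derivable w t 1 -> 0 < e -> exists2 delta : R, 0 < delta &
  forall h : R, `|h| < delta ->
    `|w (t + h) - w t - w^`()%classic t * h| <= e * `|h|.
Proof.
move=> wt e0; have {wt} : h^-1 *: (w (h *: 1 + t) - w t) @[h --> 0^'] --> 'D_1 w t.
  by [].
rewrite -derive1E => /cvgrPdist_le /(_ e e0) /nbhs_normP[delta /= delta0 hdelta].
exists delta => // h hd.
have [->|h0] := eqVneq h 0; first by rewrite addr0 subrr mulr0 subrr normr0 mulr0.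
have := hdelta h; rewrite /= sub0r normrN => /(_ hd h0).
rewrite distrC -(ler_pM2r (x := `|h|)) ?normr_gt0// -normrM mulrBl.
by rewrite -[_ *: _]/(_ * _) -[h *: 1]/(h * 1) mulr1 (addrC h) mulrAC mulVf// mul1r.
Qed.

(** With [S] the sum of the [a i] and [Q] the sum of their squares, the squares of [n a_i - S] add
    up to [n (n Q - S^2)], which is therefore nonnegative. *)
Lemma sqr_sum_le (R : realFieldType) (n : nat) (a : nat -> R) :
  (\sum_(i < n) a i) ^+ 2 <= n%:R * \sum_(i < n) a i ^+ 2.
Proof.
case: n => [|n]; first by rewrite !big_ord0 expr0n mulr0.
set S := \sum_(i < n.+1) a i; set Q := \sum_(i < n.+1) a i ^+ 2.
have n0 : (0 : R) < n.+1%:R by [].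
have : 0 <= \sum_(i < n.+1) (n.+1%:R * a i - S) ^+ 2.
  by apply: sumr_ge0 => i _; exact: sqr_ge0.
under eq_bigr do rewrite sqrrB exprMn.
rewrite big_split/= sumrB -mulr_sumr -/Q sumr_const card_ord -(mulr_natr (S ^+ 2)).
have -> : \sum_(i < n.+1) n.+1%:R * a i * S *+ 2 = n.+1%:R * S ^+ 2 *+ 2.
  by rewrite sumrMnl -mulr_suml -mulr_sumr expr2 mulrA.
move=> h; rewrite -(ler_pM2l n0); move: h; rewrite expr2; lra.
Qed.

Lemma norm_telescope (R : realType) (E : normedModType R) (z : nat -> E) i n :
  (i <= n)%N -> `|z n - z i| <= \sum_(j < n) `|z j.+1 - z j|.
Proof.
elim: n => [|n ih]; first by rewrite leqn0 => /eqP ->; rewrite subrr normr0 big_ord0.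
rewrite leq_eqVlt => /orP[/eqP ->|]; first by rewrite subrr normr0 sumr_ge0.
rewrite ltnS => /ih h; rewrite big_ord_recr/=.
by apply: le_trans (ler_distD (z n) _ _) _; rewrite addrC lerD.
Qed.

(** * Finite length of KL descent sequences *)

(* The one-step estimate
     2 D_(k+1) <= D_k + (b/a) (w (F_(k+1) - Fs) - w (F_(k+2) - Fs))
   telescopes as long as the iterates stay in the ball where the KL inequality
   holds, and its telescoped form keeps them in that ball. *)
Lemma kl_finite_length (R : realType) (E : normedModType R) (x : nat -> E)
  (xhat : E) (D F : nat -> R) (Fs a b rho r : R) (w : R -> R) :
  0 < a -> 0 <= b -> 0 < rho -> 0 < r ->
  (forall k, 0 <= D k) ->
  (forall k, `|x k.+1 - x k| <= D k) ->
  (forall k, F k.+1 + a * D k ^+ 2 <= F k) ->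
  (forall (e : R) n, 0 < e -> exists2 k, (n <= k)%N &
    `|x k - xhat| < e /\ `|F k - Fs| < e) ->
  (forall t : R, 0 <= t -> t < r -> 0 <= w t) ->
  (forall e : R, 0 < e -> exists2 delta : R, 0 < delta &
    forall t : R, 0 <= t -> t < delta -> w t <= e) ->
  (forall k, `|x k.+1 - xhat| < rho -> 0 < F k.+1 - Fs -> F k.+1 - Fs < r ->
    forall s : R, 0 <= s <= F k.+1 - Fs ->
    F k.+1 - Fs - s <= (w (F k.+1 - Fs) - w s) * (b * D k)) ->
  [/\ exists B : R, forall n, \sum_(k < n) D k <= B, D @ \oo --> 0
    & x @ \oo --> xhat].
Proof.
move=> a0 b0 rho0 r0 D0 xD FD cl w0 wc kl.
have Fdec m n : (m <= n)%N -> F n <= F m.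
  move=> /subnK <-; elim: (n - m)%N => [//|j ih]; rewrite addSn.
  apply: le_trans ih; apply: le_trans (FD _); rewrite lerDl.
  by rewrite mulr_ge0 ?sqr_ge0 ?ltW.
(* [F] is nonincreasing and [Fs] is one of its cluster values, so [Fs] is both a lower bound and the
   limit. *)
have FsF k : Fs <= F k.
  rewrite leNgt; apply/negP => h; have e0 : 0 < Fs - F k by lra.
  have [n kn [_ ]] := cl _ k e0; have := Fdec _ _ kn.
  by move=> h1; rewrite ltr_norml => /andP[]; lra.
have FtoFs (e : R) : 0 < e -> exists n, forall k, (n <= k)%N -> F k - Fs < e.
  move=> e0; have [n _ [_ hn]] := cl e 0%N e0; exists n => k nk.
  have := Fdec _ _ nk; move: hn; rewrite ltr_norml => /andP[_]; lra.
have Dto0 (e : R) : 0 < e -> exists n, forall k, (n <= k)%N -> D k < e.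
  move=> e0; have ae : 0 < a * e ^+ 2 by rewrite mulr_gt0 ?exprn_gt0.
  have [n hn] := FtoFs _ ae; exists n => k nk.
  rewrite -(@ltr_pXn2r _ 2)// ?nnegrE ?(ltW e0)// -(ltr_pM2l a0).
  by have := hn _ nk; have := FsF k.+1; have := FD k; lra.
pose c := b / a; have c0 : 0 <= c by rewrite divr_ge0// ltW.
have step k : `|x k.+1 - xhat| < rho -> F k.+1 - Fs < r ->
    2 * D k.+1 <= D k + c * (w (F k.+1 - Fs) - w (F k.+2 - Fs)).
  move=> xk Fk; have F1 := FsF k.+1; have F2 := FsF k.+2; have F12 := FD k.+1.
  have aD : 0 <= a * D k.+1 ^+ 2 by rewrite mulr_ge0 ?sqr_ge0 ?ltW.
  (* When the limit value is already attained the KL estimate says nothing, but [F] is then constant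
     and the descent forces [D k.+1 = 0]. *)
  have [F0|F0] := eqVneq (F k.+1) Fs.
    have -> : F k.+2 = F k.+1 by lra.
    have /eqP : a * D k.+1 ^+ 2 = 0 by lra.
    rewrite mulf_eq0 sqrf_eq0 gt_eqF//= => /eqP ->.
    by rewrite subrr !mulr0 addr0.
  have Fpos : 0 < F k.+1 - Fs by rewrite subr_gt0 lt_neqAle eq_sym F0.
  have kl' := kl k xk Fpos Fk.
  (* The choice [s = 0] serves only to exclude [D k = 0]; the choice [s = F k.+2 - Fs] bounds the
     decrease of [F], hence [a * D k.+1 ^+ 2]. *)
  have h0 := kl' 0; have h1 := kl' (F k.+2 - Fs).
  rewrite lexx ltW// in h0; have {h0} := h0 isT.
  have s01 : 0 <= F k.+2 - Fs <= F k.+1 - Fs by apply/andP; split; lra.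
  have {h1} := h1 s01; set W1 := w (F k.+1 - Fs); set W2 := w (F k.+2 - Fs) => h1 h0.
  have Dk0 : 0 < D k.
    rewrite lt_neqAle D0 eq_sym andbT; apply/eqP => Dk; move: h0; rewrite Dk !mulr0; lra.
  set q := c * (W1 - W2).
  have hq : D k.+1 ^+ 2 <= D k * q.
    have -> : D k * q = ((W1 - W2) * (b * D k)) / a by rewrite /q /c; field; rewrite gt_eqF.
    rewrite ler_pdivlMr//; lra.
  have q0 : 0 <= q by rewrite -(pmulr_rge0 _ Dk0) (le_trans _ hq)// sqr_ge0.
  (* Arithmetic-geometric mean: [(2 D_(k+1))^2 <= 4 D_k q <= (D_k + q)^2]. *)
  rewrite -(@ler_pXn2r _ 2)// ?nnegrE ?addr_ge0// ?mulr_ge0//.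
  have := sqr_ge0 (D k - q); rewrite sqrrB sqrrD exprMn; lra.
(* The radius [rho] will give summability, and arbitrarily small radii will give convergence. *)
have main (rho' : R) : 0 < rho' -> rho' <= rho -> exists m, forall n,
    \sum_(j < n) D (m + j).+1 <= rho' /\ `|x (m + n).+1 - xhat| < rho'.
  move=> r'0 r'r; have e0 : 0 < rho' / 8 by lra.
  have c1 : 0 < c + 1 by lra.
  have [delta d0 hw] := wc (rho' / 8 / (c + 1)) (divr_gt0 e0 c1).
  have [n1 hn1] := Dto0 _ e0.
  pose e := Num.min (rho' / 8) (Num.min delta r).
  have ee0 : 0 < e by rewrite !lt_min e0 d0.
  (* The index is positive, [k = m.+1] with [m >= n1], because the recursion starts from the
     previous length [D m]. *)
  have [k nk [xk Fk]] := cl e n1.+1 ee0.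
  case: k nk xk Fk => // m nk xk Fk; exists m.
  have {}xk : `|x m.+1 - xhat| < rho' / 8.
    by apply: lt_le_trans xk _; rewrite ge_min lexx.
  have Fm := FsF m.+1; rewrite ger0_norm ?subr_ge0// in Fk.
  have Fd : F m.+1 - Fs < delta.
    by apply: lt_le_trans Fk _; rewrite !ge_min lexx orbT.
  have Fr : F m.+1 - Fs < r.
    by apply: lt_le_trans Fk _; rewrite !ge_min lexx !orbT.
  have {hw} wm : c * w (F m.+1 - Fs) <= rho' / 8.
    have Fm0 : 0 <= F m.+1 - Fs by rewrite subr_ge0.
    have := hw _ Fm0 Fd; rewrite ler_pdivlMr//.
    have := w0 _ Fm0 Fr; lra.
  have Dm : D m < rho' / 8 by apply: hn1; rewrite -ltnS.
  have Fmn n : F (m + n).+1 - Fs < r.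
    have := Fdec m.+1 (m + n).+1; rewrite ltnS leq_addr => /(_ isT); lra.
  have cw n : 0 <= c * w (F (m + n).+1 - Fs).
    by rewrite mulr_ge0// w0// subr_ge0.
  (* Both bounds go through the induction together: the sum keeps the next iterate in the ball, and
     being in the ball allows the next use of [step]. The three initial terms, each at most
     [rho' / 8], leave room to spare. *)
  have claim n : \sum_(j < n) D (m + j).+1 + D (m + n)%N
        + c * w (F (m + n).+1 - Fs) <= D m + c * w (F m.+1 - Fs)
      /\ `|x (m + n).+1 - xhat| <= `|x m.+1 - xhat| + \sum_(j < n) D (m + j).+1.
    elim: n => [|n [ih1 ih2]]; first by rewrite big_ord0 add0r addr0 addn0.
    have xn : `|x (m + n).+1 - xhat| < rho.
      by have := cw n; have := D0 (m + n)%N; lra.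
    have := step _ xn (Fmn n); rewrite !big_ord_recr/= addnS => st; split; first lra.
    have := ler_normD (x (m + n).+2 - x (m + n).+1) (x (m + n).+1 - xhat).
    rewrite addrA subrK; have := xD (m + n).+1; lra.
  move=> n; have [h1 h2] := claim n; have := cw n; have := D0 (m + n)%N.
  by split; lra.
split.
  have [m hm] := main rho rho0 (lexx _); exists (\sum_(k < m.+1) D k + rho) => n.
  have [nm|mn] := leqP n m.+1.
    rewrite -(subnKC nm) big_split_ord/= -addrA lerDl addr_ge0 ?(ltW rho0)//.
    by apply: sumr_ge0.
  rewrite -(subnKC (ltnW mn)) big_split_ord/= lerD2l.
  by case: (hm (n - m.+1)%N).
  apply/cvgrPdist_lt => e e0; have [n hn] := Dto0 e e0; exists n => // k /= nk.
  by rewrite sub0r normrN ger0_norm// hn.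
apply/cvgrPdist_le => e e0.
pose rho' := Num.min e rho; have r'0 : 0 < rho' by rewrite lt_min e0.
have r'r : rho' <= rho by rewrite ge_min lexx orbT.
have [m {}main] := main rho' r'0 r'r; have hm n := (main n).2.
exists m.+1 => // n /= mn; rewrite distrC.
have := hm (n - m.+1)%N; rewrite -addSn subnKC// => /ltW /le_trans; apply.
by rewrite ge_min lexx.
Qed.

(** * Finite-dimensional inner product spaces and their direct sums *)

Section InnerProduct.
Variables (R : realType) (H : innerType R).
Implicit Types x y z : H.

Lemma inner0l y : inner 0 y = 0.
Proof. by rewrite -(scale0r (0 : H)) innerZl mul0r. Qed.

Lemma innerNl x y : inner (- x) y = - inner x y.
Proof. by rewrite -scaleN1r innerZl mulN1r. Qed.

Lemma innerDr x y z : inner x (y + z) = inner x y + inner x z.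
Proof. by rewrite innerC innerDl !(innerC _ x). Qed.

Lemma innerZr (a : R) x y : inner x (a *: y) = a * inner x y.
Proof. by rewrite innerC innerZl innerC. Qed.

Lemma inner_suml (I : Type) (s : seq I) (F : I -> H) y :
  inner (\sum_(i <- s) F i) y = \sum_(i <- s) inner (F i) y.
Proof.
elim/big_rec2 : _ => [|i a b _ <-]; first by rewrite inner0l.
by rewrite innerDl.
Qed.

Lemma inner_le_norm x y : `|inner x y| <= `|x| * `|y|.
Proof.
have H0 (u v : H) : inner u v <= `|u| * `|v|.
  have [/eqP|u0] := eqVneq `|u| 0.
    by rewrite normr_eq0 => /eqP ->; rewrite inner0l mulr_ge0.
  have [/eqP|v0] := eqVneq `|v| 0.
    by rewrite normr_eq0 => /eqP ->; rewrite innerC inner0l mulr_ge0.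
  have {}u0 : 0 < `|u| by rewrite lt_neqAle eq_sym u0 normr_ge0.
  have {}v0 : 0 < `|v| by rewrite lt_neqAle eq_sym v0 normr_ge0.
  rewrite -(ler_pM2l (mulr_gt0 u0 v0)).
  have : 0 <= inner (`|v| *: u - `|u| *: v) (`|v| *: u - `|u| *: v).
    by rewrite inner_norm sqr_ge0.
  rewrite -scaleNr !(innerDl, innerDr, innerZl, innerZr) (innerC v u) !inner_norm.
  by lra.
by rewrite ler_norml lerNl -innerNl H0 -(normrN x) H0.
Qed.

End InnerProduct.

(** * Riesz representation and coordinates in one block *)

Section FiniteDim.
Variables (R : realType) (V : euclideanType R).
Local Notation b := (vbasis {:V}%VS).
Local Notation n := (\dim {:V}%VS).

Let gram : 'M[R]_n := \matrix_(i, j) inner b`_i b`_j.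

Let inner_comb (c : 'rV[R]_n) (j : 'I_n) :
  inner (\sum_i c 0 i *: b`_i) b`_j = (c *m gram) 0 j.
Proof.
rewrite inner_suml mxE; apply: eq_bigr => i _.
by rewrite innerZl mxE.
Qed.

(** A vector in the kernel gives a combination [y] orthogonal to the whole basis, hence to itself,
    so [y = 0] and freeness applies. *)
Let gram_unit : gram \in unitmx.
Proof.
rewrite -row_free_unit; apply: inj_row_free => c c0.
pose y := \sum_i c 0 i *: b`_i.
have yb (j : 'I_n) : inner y b`_j = 0 by rewrite inner_comb c0 mxE.
have /eqP : inner y y = 0.
  rewrite {1}/y inner_suml big1// => i _.
  by rewrite innerZl innerC yb mulr0.
rewrite inner_norm sqrf_eq0 normr_eq0 => /eqP y0.
apply/rowP => i; rewrite mxE.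
have /freeP := basis_free (vbasisP {:V}%VS); apply.
exact: y0.
Qed.

Let basis_comb (x : V) : x = \sum_(i < n) coord b i x *: b`_i.
Proof. by apply: coord_vbasis; exact: memvf. Qed.

Lemma riesz_block (g : V -> R) : (forall u v, g (u + v) = g u + g v) ->
  (forall a u, g (a *: u) = a * g u) -> exists u, forall h, g h = inner u h.
Proof.
move=> gD gZ.
have gsum (s : seq 'I_n) (F : 'I_n -> V) :
    g (\sum_(i <- s) F i) = \sum_(i <- s) g (F i).
  elim/big_rec2 : _ => [|i x y _ <-//].
  by rewrite -(scale0r (0 : V)) gZ mul0r.
pose c := (\row_j g b`_j) *m invmx gram.
exists (\sum_i c 0 i *: b`_i) => h.
rewrite (basis_comb h) gsum innerC inner_suml; apply: eq_bigr => i _.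
by rewrite gZ innerZl innerC inner_comb mulmxKV// mxE.
Qed.

(** Each coordinate is a linear form, hence an inner product with a fixed vector, and Cauchy-Schwarz
    bounds it. *)
Lemma coord_le_norm : exists2 C : R, 0 <= C &
  forall (x : V) i, `|coord b i x| <= C * `|x|.
Proof.
have /choice[e he] : forall i : 'I_n, exists e, forall x, coord b i x = inner e x.
  by move=> i; apply: riesz_block => [u v|a u]; rewrite ?linearD ?linearZ.
exists (\sum_i `|e i|) => [|x i]; first exact: sumr_ge0.
rewrite he; apply: le_trans (inner_le_norm _ _) _; rewrite ler_wpM2r//.
by rewrite (bigD1 i)//= lerDl sumr_ge0.
Qed.

Lemma norm_le_coord (c : 'I_n -> R) (x : V) :
  `|x - \sum_i c i *: b`_i| <= \sum_i `|coord b i x - c i| * `|b`_i|.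
Proof.
rewrite {1}(basis_comb x) -sumrB; apply: le_trans (ler_norm_sum _ _ _) _.
by apply: ler_sum => i _; rewrite -scalerBl normrZ.
Qed.

End FiniteDim.

(** * The direct sum: norms, gradients, compactness *)

Section HsumTheory.
Context {R : realType} {L : nat} {V : 'I_L -> euclideanType R}.
Local Notation H := (hsum V).
Implicit Types x y z : H.

Lemma hsum_innerE x y : inner x y = \sum_l inner (x l) (y l).
Proof. by []. Qed.

Lemma hsum_normE x : `|x| ^+ 2 = \sum_l `|x l| ^+ 2.
Proof.
by rewrite -inner_norm hsum_innerE; apply: eq_bigr => l _; rewrite inner_norm.
Qed.

Lemma hsum_addE x y l : (x + y) l = x l + y l. Proof. by []. Qed.

Lemma hsum_subE x y l : (x - y) l = x l - y l. Proof. by []. Qed.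

Lemma hsum_sumE (I : Type) (s : seq I) (F : I -> H) l :
  (\sum_(i <- s) F i) l = \sum_(i <- s) F i l.
Proof. by elim/big_rec2 : _ => [//|i a c _ <-]. Qed.

Lemma block_norm_le x l : `|x l| <= `|x|.
Proof.
rewrite -(@ler_pXn2r _ 2)// ?nnegrE// hsum_normE (bigD1 l)//= lerDl.
by apply: sumr_ge0 => j _; exact: sqr_ge0.
Qed.

Lemma hsum_norm_le_sum x : `|x| <= \sum_l `|x l|.
Proof.
rewrite -(@ler_pXn2r _ 2)// ?nnegrE// ?sumr_ge0// hsum_normE.
have : 0 <= \sum_l `|x l| /\ \sum_l `|x l| ^+ 2 <= (\sum_l `|x l|) ^+ 2.
  elim/big_rec2 : _ => [|l s t _ [s0 st]]; first by rewrite expr0n.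
  split; first by rewrite addr_ge0.
  have := mulr_ge0 (normr_ge0 (x l)) s0; rewrite sqrrD; lra.
by case.
Qed.

Lemma dfwith0_sum x : x = \sum_l (dfwith (0 : H) l (x l) : H).
Proof.
apply: functional_extensionality_dep => j; rewrite hsum_sumE (bigD1 j)//= dfwithin.
by rewrite big1 ?addr0// => i ij; rewrite dfwithout.
Qed.

(** A linear form on the direct sum is the sum of its restrictions to the blocks; their
    representatives are the blocks of the one sought. *)
Lemma riesz_hsum (g : H -> R) : (forall u v, g (u + v) = g u + g v) ->
  (forall a u, g (a *: u) = a * g u) -> exists u, forall h, g h = inner u h.
Proof.
move=> gD gZ.
have gsum (s : seq 'I_L) (F : 'I_L -> H) :
    g (\sum_(i <- s) F i) = \sum_(i <- s) g (F i).
  elim/big_rec2 : _ => [|i x y _ <-//].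
  by rewrite -(scale0r (0 : H)) gZ mul0r.
have Hl l : exists u : V l, forall h, g (dfwith (0 : H) l h) = inner u h.
  apply: riesz_block => [u v|a u].
    rewrite -gD; congr g; apply: functional_extensionality_dep => j.
    rewrite hsum_addE; have [<-|lj] := eqVneq l j; first by rewrite !dfwithin.
    by rewrite !dfwithout// addr0.
  rewrite -gZ; congr g; apply: functional_extensionality_dep => j.
  rewrite [RHS](_ : _ = a *: (dfwith (0 : H) l u : H) j)//.
  have [<-|lj] := eqVneq l j; first by rewrite !dfwithin.
  by rewrite !dfwithout// scaler0.
exists (fun l => sval (cid (Hl l))) => h.
rewrite {1}(dfwith0_sum h) gsum hsum_innerE; apply: eq_bigr => l _.
exact: (svalP (cid (Hl l))).
Qed.

(** [grad] selects a representative with [xget]; [riesz_hsum] shows that there is one to select. *)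
Lemma grad_inner (f : H -> R) x : differentiable f x ->
  forall h, 'd f x h = inner (grad f x) h.
Proof.
move=> df; have : exists u, forall h, 'd f x h = inner u h.
  by apply: riesz_hsum => [u v|a u]; rewrite ?linearD ?linearZ.
move=> /(@xgetPex _ 0 [set u | forall h, 'd f x h = inner u h]); exact.
Qed.

Lemma grad_expansion (f : H -> R) x (e : R) : differentiable f x -> 0 < e ->
  \forall y \near x, `|f y - f x - inner (grad f x) (y - x)| <= e * `|y - x|.
Proof.
move=> df e0.
have /eqoP/(_ _ e0) ho : (fun h => f (h + x) - f x - 'd f x h) =o_ 0 id.
  apply/eqoE/funext => h; rewrite (diff_locallyx df).
  have cancel (p q o : R) : p + q + o - p - q = o by ring.
  exact: cancel.
rewrite (near_shift 0)/= subr0; near=> h.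
rewrite /= addrK -grad_inner//.
by near: h.
Unshelve. all: by end_near. Qed.

(** Bolzano-Weierstrass: the coordinates of all blocks, indexed by the pairs (block, basis index),
    form a single row vector that stays in a compact box. *)
Lemma hsum_cluster (x : nat -> H) (M : R) : (forall k, `|x k| <= M) ->
  exists xhat, forall (e : R) n, 0 < e -> exists2 k, (n <= k)%N & `|x k - xhat| < e.
Proof.
move=> xM.
pose I := {l : 'I_L & 'I_(\dim {:V l}%VS)}.
pose B l := vbasis {:V l}%VS.
have /choice[C hC] : forall l, exists C : R, forall (y : V l) i,
    `|coord (B l) i y| <= C * `|y|.
  by move=> l; have [C _ hC] := coord_le_norm (V l); exists C.
pose c k : 'rV[R]_#|{: I}| := \row_i
  coord (B (tag (enum_val i))) (tagged (enum_val i)) (x k (tag (enum_val i))).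
pose K (i : 'I_#|{: I}|) : set R :=
  [set` `[- (`|C (tag (enum_val i))| * M), `|C (tag (enum_val i))| * M]].
have Kc : compact [set v : 'rV[R]_#|{: I}| | forall i, K i (v ord0 i)].
  by apply: rV_compact => i; exact: segment_compact.
have cK k : [set v : 'rV[R]_#|{: I}| | forall i, K i (v ord0 i)] (c k).
  move=> i; rewrite /K/= in_itv/= -ler_norml mxE.
  apply: le_trans (hC _ _ _) _.
  apply: (@le_trans _ _ (`|C (tag (enum_val i))| * `|x k (tag (enum_val i))|)).
    by rewrite ler_wpM2r// ler_norm.
  by rewrite ler_wpM2l// (le_trans (block_norm_le _ _)).
have cA : (c @ \oo) [set v | forall i, K i (v ord0 i)].
  by exists 0%N => // k _; exact: cK.
have [a [_ ha]] := Kc (c @ \oo) _ cA.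
pose tg l (j : 'I_(\dim {:V l}%VS)) : I := existT _ l j.
pose xh : H := fun l => \sum_j a 0 (enum_rank (tg l j)) *: (B l)`_j.
exists xh => e n e0.
pose S := \sum_l \sum_(j < \dim {:V l}%VS) `|(B l)`_j|.
have S0 : 0 <= S by apply: sumr_ge0 => l _; apply: sumr_ge0.
(* An error [d] on every coordinate costs at most [d * S] in norm; [S + 1] avoids dividing by
   zero. *)
have d0 : 0 < e / (S + 1) by rewrite divr_gt0// ltr_wpDl.
have [_ [[k nk <-] hk]] :
    ((c @` [set k | (n <= k)%N]) `&` ball a (e / (S + 1))) !=set0.
  apply: ha; last exact: nbhsx_ballx.
  by exists n => // k /= nk; exists k.
exists k => //; apply: le_lt_trans (hsum_norm_le_sum _) _.
apply: (@le_lt_trans _ _ (e / (S + 1) * S)); last first.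
  by rewrite mulrAC ltr_pdivrMr ?ltr_wpDl// ltr_pM2l// ltrDl.
rewrite mulr_sumr; apply: ler_sum => l _; apply: le_trans (norm_le_coord _ _) _.
rewrite mulr_sumr; apply: ler_sum => j _; rewrite ler_wpM2r//.
case: hk => _ /(_ 0 (enum_rank (tg l j))).
by rewrite /ball/= mxE enum_rankK/= distrC => /ltW.
Qed.

(** Pass from [y] to [x] by changing one block at a time: [z m] has its first [m] blocks from [x]
    and the others from [y]. *)
Lemma grad_lipschitz (f : H -> R) : block_lipschitz_grad f ->
  exists2 K : R, 0 <= K & forall x y l, `|grad f x l - grad f y l| <= K * `|x - y|.
Proof.
move=> flip.
have /choice[B hB] : forall p : 'I_L * 'I_L, exists B : R, 0 < B /\
    forall (x : H) (v : V p.2),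
      `|grad f (x + (dfwith (0 : H) p.2 v : H)) p.1 - grad f x p.1| <= B * `|v|.
  by move=> [l j]; have [B B0 h] := flip l j; exists B.
exists (\sum_p B p) => [|x y l]; first by apply: sumr_ge0 => p _; case: (hB p) => /ltW.
pose z (m : nat) : H := fun l => if (l < m)%N then x l else y l.
have zS (j : 'I_L) : z j.+1 = z j + (dfwith (0 : H) j ((x - y) j) : H).
  apply: functional_extensionality_dep => i; rewrite hsum_addE /z.
  have [<-|ji] := eqVneq j i; first by rewrite dfwithin ltnSn ltnn hsum_subE addrC subrK.
  by rewrite dfwithout// addr0 ltnS leq_eqVlt (inj_eq val_inj) eq_sym (negbTE ji).
have z0 : z 0%N = y by apply: functional_extensionality_dep.
have zL : z L = x by apply: functional_extensionality_dep => i; rewrite /z ltn_ord.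
have main m : (m <= L)%N ->
    `|grad f (z m) l - grad f y l| <= (\sum_(j < L | (j < m)%N) B (l, j)) * `|x - y|.
  elim: m => [|m ih] mL; first by rewrite z0 subrr normr0 big1 ?mul0r.
  have := ih (ltnW mL); have := (hB (l, Ordinal mL)).2 (z m) ((x - y) (Ordinal mL)).
  rewrite -(zS (Ordinal mL))/= => h1 h2.
  rewrite (bigD1 (Ordinal mL))//= mulrDl.
  have -> : \sum_(j < L | (j < m.+1)%N && (j != Ordinal mL)) B (l, j)
      = \sum_(j < L | (j < m)%N) B (l, j).
    apply: eq_bigl => j; rewrite ltnS ltn_neqAle andbC; congr (_ && _).
  apply: le_trans (ler_distD (grad f (z m) l) _ _) _; apply: lerD => //.
  apply: le_trans h1 _; rewrite ler_wpM2l ?block_norm_le//.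
  by case: (hB (l, Ordinal mL)) => /ltW.
have := main L (leqnn L); rewrite zL => /le_trans; apply.
rewrite ler_wpM2r//.
have Bge0 p : 0 <= B p by case: (hB p) => /ltW.
rewrite (eq_bigl xpredT) => [|j]; last exact: ltn_ord.
have -> : \sum_p B p = \sum_l \sum_j B (l, j).
  by rewrite pair_bigA; apply: eq_bigr => -[].
rewrite [leRHS](bigD1 l)//= lerDl.
by apply: sumr_ge0 => i _; apply: sumr_ge0.
Qed.

End HsumTheory.

(** * Subdifferentials *)

Lemma lipschitz_onP (R : realType) (U W : normedModType R) (F : U -> W)
  (A : set U) : [lipschitz F s | s in A] ->
  exists2 K : R, 0 <= K & forall s t, A s -> A t -> `|F s - F t| <= K * `|s - t|.
Proof.
move=> FA; have [K K0 h] := pinfty_ex_gt (num_real 0) FA.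
by exists K => [|s t As At]; [exact: ltW|exact: (h (s, t))].
Qed.

Section ConvexSubdifferential.
Variables (R : realType) (H : innerType R).
Implicit Types (h : H -> \bar R) (x y u : H).

(* Meaningful for [h x] finite only: [fine (h x)] is [0] otherwise. *)
Definition convex_subgrad h x u := forall y, (h y < +oo)%E ->
  fine (h x) + inner u (y - x) <= fine (h y).

Lemma psi_regular_fin h x : psi_regular h -> (h x < +oo)%E -> h x \is a fin_num.
Proof. by case=> h0 _ _ _ _ hx; rewrite ge0_fin_numE. Qed.

(** The local inequality is tested at [t *: y + (1 - t) *: x] for a small [t]; convexity bounds [h]
    there, and dividing by [t] makes the inequality global. *)
Lemma frechet_convex h x u : psi_regular h ->
  frechet_subdiff h x u -> convex_subgrad h x u.
Proof.
move=> hreg [hx hu] y hy; have hyf := psi_regular_fin hreg hy.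
have [-> |xy] := eqVneq y x; first by rewrite subrr innerC inner0l addr0.
have xy0 : 0 < `|y - x| by rewrite normr_gt0 subr_eq0.
case: hreg => _ hconv _ _ _.
suff main (e : R) : 0 < e ->
    fine (h x) + inner u (y - x) <= fine (h y) + e * `|y - x|.
  rewrite leNgt; apply/negP => lt.
  have e0 : 0 < (fine (h x) + inner u (y - x) - fine (h y)) / 2 / `|y - x|.
    by rewrite divr_gt0// divr_gt0// subr_gt0.
  by have := main _ e0; rewrite divfK ?gt_eqF//; lra.
move=> e0; have /nbhs_normP[d /= d0 hd] := hu e e0.
pose t := Num.min 1 (d / (2 * `|y - x|)).
have t0 : 0 < t by rewrite lt_min ltr01 divr_gt0// mulr_gt0.
have t1 : t <= 1 by rewrite ge_min lexx.
have td : t * `|y - x| < d.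
  have : t <= d / (2 * `|y - x|) by rewrite ge_min lexx orbT.
  rewrite ler_pdivlMr ?mulr_gt0//; lra.
pose z := t *: y + (1 - t) *: x.
have zx : z - x = t *: (y - x).
  by rewrite /z scalerBl scale1r scalerBr -addrA (addrAC x) subrr add0r.
have := hd z; rewrite /= distrC zx normrZ gtr0_norm// => /(_ td).
have := hconv y x t; rewrite (ltW t0) t1 => /(_ isT) /[swap] h1 /(le_trans h1).
rewrite -(fineK hx) -(fineK hyf) -!EFinM -!EFinD lee_fin innerZr => h2.
by rewrite -(ler_pM2l t0); lra.
Qed.

Lemma cvg_inner (v y : nat -> H) u x : v @ \oo --> u -> y @ \oo --> x ->
  inner (v n) (y n) @[n --> \oo] --> inner u x.
Proof.
(* Polarization reduces joint continuity of the inner product to that of the norm. *)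
have polar a b : inner a b = (`|a + b| * `|a + b| - `|a - b| * `|a - b|) / 4.
  rewrite -!expr2 -!inner_norm !(innerDl, innerDr) !innerNl.
  by rewrite !(innerC _ (- b)) !innerNl (innerC b a); lra.
move=> vu yx; rewrite polar; under eq_fun do rewrite polar.
apply: cvgMl; apply: cvgB; apply: cvgM; apply: cvg_norm;
  by [exact: cvgD|exact: cvgB].
Qed.

(** The global subgradient inequality at the approximating points passes to the limit, since their
    values converge too. *)
Lemma limiting_convex h x u : psi_regular h ->
  limiting_subdiff h x u -> convex_subgrad h x u.
Proof.
move=> hreg [hx [y [v [yx hyx hfr vu]]]] z hz.
have hyx' : (fine \o (h \o y)) n @[n --> \oo] --> fine (h x).
  by apply: fine_cvg; rewrite fineK.
have lim : fine (h (y n)) + inner (v n) (z - y n) @[n --> \oo] -->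
    fine (h x) + inner u (z - x).
  apply: cvgD => //; apply: cvg_inner => //; apply: cvgB => //; exact: cvg_cst.
apply: (ler_cvg_to lim (@cvg_cst _ (fine (h z)) _ _ _)).
by apply: nearW => n; apply: frechet_convex.
Qed.

End ConvexSubdifferential.

Lemma frechet_limiting (R : realType) (H : innerType R) (h : H -> \bar R) x u :
  frechet_subdiff h x u -> limiting_subdiff h x u.
Proof.
move=> hu; split; first by case: hu.
exists (fun=> x), (fun=> u); split => //; exact: cvg_cst.
Qed.

(* The last inequality combines [1 <= w'(d) dist(0, dPsi u)] with the tangent
   inequality of the concave function [w] at [d = Psi u - Psi xt]. *)
Lemma KL_desingularize (R : realType) (H : innerType R) (Psi : H -> \bar R)
  (xt : H) (a : R) : Psi xt = a%:E -> KL_at Psi xt ->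
  exists rho r : R, exists w : R -> R, [/\ 0 < rho, 0 < r,
    forall t : R, 0 <= t -> t < r -> 0 <= w t,
    forall e : R, 0 < e -> exists2 delta : R, 0 < delta &
      forall t : R, 0 <= t -> t < delta -> w t <= e &
    forall (u v : H) (b B : R), `|u - xt| < rho -> Psi u = b%:E ->
      limiting_subdiff Psi u v -> `|v| <= B ->
      0 < b - a -> b - a < r ->
      forall s : R, 0 <= s <= b - a -> b - a - s <= (w (b - a) - w s) * B].
Proof.
move=> Pxt [r' [U [w [r'0 [Ux [[w0 w00 wcont wconc] [wder kl]]]]]]].
(* [r'] may be [+oo], in which case the real radius 1 is taken. *)
have [r r0 rr'] : exists2 r : R, 0 < r & (r%:E <= r')%E.
  case: r' r'0 {wcont w0 wconc wder kl} => [r|//|//] r0; first by exists r.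
  by exists 1 => //; exact: leey.
have inr t : t < r -> (t%:E < r')%E by move=> tr; apply: lt_le_trans rr'.
have /nbhs_normP[rho /= rho0 hrho] := Ux.
exists rho, r, w; split => // [t t0 tr|e e0|u v b B uxt Pu vsub vB d0 dr s /andP[s0 sd]].
- by apply: w0; split => //; exact: inr.
- have /subspace_continuousP/(_ 0) h0 := wcont.
  have {}h0 := h0 (conj (lexx _) r'0).
  move/cvgrPdist_le : h0 => /(_ e e0); rewrite near_withinE.
  move=> /nbhs_normP[delta /= delta0 hdelta].
  exists (Num.min delta r) => [|t t0]; first by rewrite lt_min delta0.
  rewrite lt_min => /andP[td tr]; apply: le_trans (ler_norm _) _.
  have : `|0 - t| < delta by rewrite sub0r normrN ger0_norm.
  move=> /hdelta/(_ (conj t0 (inr t tr))).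
  by rewrite /from_subspace w00 sub0r normrN.
set d := b - a in d0 dr sd *.
have [wd _ wd0] := wder d d0 (inr d dr).
have Uu : U u by apply: hrho; rewrite /= distrC.
have ab : (a%:E < b%:E)%E by rewrite lte_fin -subr_gt0.
have br : (b%:E < a%:E + r')%E by rewrite -lteBlDl// -EFinB; exact: inr.
have := kl u Uu; rewrite Pxt Pu -EFinB => /(_ ab br) kl1.
(* [v] competes in the infimum that defines [dist0], and its norm is at most [B]. *)
have {}kl1 : 1 <= w^`()%classic d * B.
  rewrite -lee_fin; apply: (le_trans kl1); rewrite EFinM.
  apply: lee_wpmul2l; first by rewrite lee_fin ltW.
  apply: (@le_trans _ _ `|v|%:E); last by rewrite lee_fin.
  by apply: ereal_inf_lbound; exists v.
have tang : w s <= w d + w^`()%classic d * (s - d).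
  apply: concave_tangent => [c c01|e e0].
    by apply: wconc => //; split; rewrite ?(ltW d0)//; apply: inr => //; exact: le_lt_trans dr.
  have [delta delta0 hdelta] := derive1_expansion wd e0.
  exists delta => // c /andP[c0 c1] cd.
  have cE : `|c * (s - d)| = c * `|s - d| by rewrite normrM gtr0_norm.
  by rewrite -cE; apply: hdelta; rewrite cE.
have B0 : 0 <= B by apply: le_trans vB.
have ds0 : 0 <= d - s by rewrite subr_ge0.
apply: (@le_trans _ _ (w^`()%classic d * B * (d - s))); first by rewrite ler_peMl.
rewrite mulrAC ler_wpM2r//; lra.
Qed.

(** * Tangents and derivatives of the concave functions *)

Section ConcaveDerivative.
Variables (R : realType) (phi : \bar R -> \bar R).
Hypothesis reg : phi_regular phi.
Local Notation P t := (fine (phi t%:E)).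
Local Notation d := (deriv_nneg phi).

Lemma phi_fin (t : R) : 0 <= t -> phi t%:E \is a fin_num.
Proof. by case: reg => _ _ _ h _ /h[]. Qed.

Lemma phi_lt (s t : R) : 0 <= s -> s < t -> P s < P t.
Proof.
move=> s0 st; rewrite -lte_fin !fineK ?phi_fin// ?(le_trans s0 (ltW st))//.
by case: reg => _ _ h _ _; apply: h; rewrite ?lee_fin ?lte_fin.
Qed.

(** Epsilon-delta form of the limit in [deriv_nneg]; only points [s >= 0] are compared, so at
    [t = 0] the expansion is one-sided. *)
Lemma phi_expansion (t e : R) : 0 <= t -> 0 < e -> exists2 delta : R, 0 < delta &
  forall s : R, 0 <= s -> `|s - t| < delta ->
  `|P s - P t - d t * (s - t)| <= e * `|s - t|.
Proof.
move=> t0 e0; case: reg => _ _ _ /(_ t t0)[_ hc] _.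
have {hc} : slope_nneg phi t --> d t by [].
move=> /cvgrPdist_le /(_ e e0) he.
have {he} : within [set h | 0 <= t + h] 0^'
  (fun h => `|d t - (P (t + h) - P t) / h| <= e) by exact: he.
move=> /nbhs_normP[delta /= delta0 hdelta]; exists delta => // s s0 st.
have [->|neq] := eqVneq s t; first by rewrite !subrr mulr0 subrr normr0 mulr0.
have st0 : s - t != 0 by rewrite subr_eq0.
have := hdelta (s - t); rewrite /= sub0r normrN subrKC => /(_ st st0 s0).
rewrite distrC -(ler_pM2r (x := `|s - t|)) ?normr_gt0// -normrM.
by rewrite mulrBl divfK.
Qed.

Lemma phi_tangent (s t : R) : 0 <= s -> 0 <= t -> P s <= P t + d t * (s - t).
Proof.
move=> s0 t0; apply: (@concave_tangent _ (fun t => P t)) => [a /andP[a0 a1]|e e0].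
  have m0 : 0 <= a * s + (1 - a) * t by rewrite addr_ge0// mulr_ge0// subr_ge0.
  case: reg => _ /(_ s%:E t%:E a) h _ _ _; move: h.
  rewrite !lee_fin s0 t0 a0 a1 => /(_ isT isT isT).
  rewrite -!EFinM -EFinD -(fineK (phi_fin s0)) -(fineK (phi_fin t0)).
  by rewrite -(fineK (phi_fin m0)) -!EFinM -EFinD lee_fin.
have [delta delta0 h] := phi_expansion t0 e0.
exists delta => // a /andP[a0 a1] ad.
have E : t + a * (s - t) - t = a * (s - t) by ring.
have m0 : 0 <= t + a * (s - t).
  have -> : t + a * (s - t) = a * s + (1 - a) * t by ring.
  by rewrite addr_ge0// mulr_ge0// ?subr_ge0// ltW.
by have := h _ m0; rewrite E normrM gtr0_norm//; apply.
Qed.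

(** The tangent at [t], evaluated at [T + 1], gives [P (T + 1) <= P t + d t * (T + 1 - t)]. Here
    [P t <= P T] and [d t * t >= 0], so [d t * (T + 1)] is at least the positive increment
    [P (T + 1) - P T]. *)
Lemma phi_deriv_bounds (T : R) : 0 <= T ->
  exists2 c : R, 0 < c & forall t : R, 0 <= t <= T -> c <= d t.
Proof.
move=> T0; exists ((P (T + 1) - P T) / (T + 1)).
  by rewrite divr_gt0 ?subr_gt0 ?phi_lt//; lra.
move=> t /andP[t0 tT]; rewrite ler_pdivrMr; last lra.
have T1 : 0 <= T + 1 by lra.
have PtT : P t <= P T.
  by move: tT; rewrite le_eqVlt => /orP[/eqP -> //|tT]; apply/ltW/phi_lt.
have := phi_tangent T1 t0; have : 0 <= d t * t.
  rewrite mulr_ge0//; have t1 : 0 <= t + 1 by lra.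
  by have := phi_tangent t1 t0; have := @phi_lt t (t + 1) t0; lra.
lra.
Qed.

Lemma phi_deriv_gt0 (t : R) : 0 <= t -> 0 < d t.
Proof.
move=> t0; have [c c0 h] := phi_deriv_bounds t0.
by apply: lt_le_trans c0 (h t _); rewrite t0 lexx.
Qed.

Lemma phi_deriv_lipschitz (T : R) : 0 <= T -> exists2 K : R, 0 <= K &
  forall s t : R, 0 <= s <= T -> 0 <= t <= T -> `|d s - d t| <= K * `|s - t|.
Proof.
move=> T0; apply: locally_lipschitz_itv => // t t0.
case: reg => _ _ _ _ /(_ t t0)[U /nbhs_normP[e /= e0 hU] /lipschitz_onP[K K0 hK]].
exists e => //; exists K => // s s' s0 s'0 se s'e.
by apply: hK; split => //; apply: hU; rewrite /= distrC.
Qed.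

End ConcaveDerivative.

(** * The composition of a concave function with a convex one *)

Section Composition.
Variables (R : realType) (H : innerType R).
Variables (psi : H -> \bar R) (phi : \bar R -> \bar R).
Hypotheses (psi_reg : psi_regular psi) (phi_reg : phi_regular phi).

Let psi_ge0 x : 0 <= fine (psi x).
Proof. by case: psi_reg => h _ _ _ _; rewrite fine_ge0. Qed.

Lemma psi_lipschitz : exists2 K : R, 0 <= K & forall x y,
  (psi x < +oo)%E -> (psi y < +oo)%E -> `|fine (psi x) - fine (psi y)| <= K * `|x - y|.
Proof. by case: psi_reg => _ _ _ _ /lipschitz_onP. Qed.

Lemma comp_continuous x (e : R) : (psi x < +oo)%E -> 0 < e ->
  \forall y \near x, (psi y < +oo)%E ->
    `|fine (phi (psi y)) - fine (phi (psi x))| < e.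
Proof.
move=> psix e0; have [K K0 hK] := psi_lipschitz.
set t := fine (psi x).
have [delta delta0 hdelta] := phi_expansion phi_reg (psi_ge0 x) ltr01.
(* The expansion of [phi] at [t] with error factor 1 bounds its increments near [t] by [c] times
   those of the argument. *)
pose c := `|deriv_nneg phi t| + 1; have c0 : 0 < c by rewrite ltr_wpDl.
have eps0 : 0 < Num.min delta (e / c) / (K + 1).
  by rewrite divr_gt0 ?ltr_wpDl// lt_min delta0 divr_gt0.
apply/nbhs_normP; exists (Num.min delta (e / c) / (K + 1)) => // y /=.
rewrite distrC ltr_pdivlMr ?ltr_wpDl// => hy psiy.
have := hK y x psiy psix; rewrite -/t => hs.
have {}hs : `|fine (psi y) - t| < Num.min delta (e / c).
  by apply: le_lt_trans hy; apply: le_trans hs _; rewrite mulrC ler_wpM2l// lerDl.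
move: hs; rewrite lt_min => /andP[h1 h2].
have := hdelta _ (psi_ge0 y) h1; rewrite !fineK ?(psi_regular_fin psi_reg)// -/t mul1r => h3.
have := ler_distD (deriv_nneg phi t * (fine (psi y) - t))
  (fine (phi (psi y)) - fine (phi (psi x))) 0.
rewrite !subr0 normrM => h4.
move: h2; rewrite ltr_pdivlMr//; rewrite /c => h2.
by apply: le_lt_trans h4 _; lra.
Qed.

(** Chain rule: expand [phi] at [psi x], then use the subgradient inequality multiplied by the
    positive derivative. The error of the expansion is controlled by [|y - x|] because [psi] is
    Lipschitz on its domain. *)
Lemma frechet_comp x w (e : R) : (psi x < +oo)%E -> convex_subgrad psi x w -> 0 < e ->
  \forall y \near x, ((fine (phi (psi x)) +
     (inner (deriv_nneg phi (fine (psi x)) *: w) (y - x) - e * `|y - x|))%:E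
     <= phi (psi y))%E.
Proof.
move=> psix hw e0; have [K K0 hK] := psi_lipschitz.
set t := fine (psi x); have t0 : 0 <= t by exact: psi_ge0.
have -> : psi x = t%:E by rewrite fineK ?(psi_regular_fin psi_reg).
set la := deriv_nneg phi t; have la0 : 0 < la by exact: phi_deriv_gt0.
have e'0 : 0 < e / (K + 1) by rewrite divr_gt0// ltr_wpDl.
have [delta delta0 hdelta] := phi_expansion phi_reg t0 e'0.
(* For [y] outside the domain, [phi (psi y)] exceeds [phi t] by at least [gap], since [phi] is
   strictly increasing up to [+oo]; the linear term stays below [gap] when [|y - x| < gap / c]. *)
pose gap := fine (phi (t + 1)%:E) - fine (phi t%:E).
have gap0 : 0 < gap by rewrite subr_gt0 phi_lt// ltrDl.
pose c := `|la *: w| + 1; have c0 : 0 < c by rewrite ltr_wpDl.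
have eps0 : 0 < Num.min (delta / (K + 1)) (gap / c).
  by rewrite lt_min !divr_gt0// ltr_wpDl.
apply/nbhs_normP; exists (Num.min (delta / (K + 1)) (gap / c)) => // y /=.
have K1 : 0 < K + 1 by rewrite ltr_wpDl.
rewrite distrC lt_min (ltr_pdivlMr _ _ K1) (ltr_pdivlMr _ _ c0) => /andP[h1 h2].
have [psiy|] := boolP (psi y < +oo)%E; last first.
  rewrite -leNgt leye_eq => /eqP ->.
  have t1 : 0 <= t + 1 by rewrite addr_ge0.
  apply: (@le_trans _ _ (phi (t + 1)%:E)); last first.
    by case: phi_reg => _ _ h _ _; rewrite ltW// h ?ltey// lee_fin.
  rewrite -(fineK (phi_fin phi_reg t1)) lee_fin.
  have := inner_le_norm (la *: w) (y - x); rewrite ler_norml => /andP[_].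
  have : 0 <= e * `|y - x| by rewrite mulr_ge0// ltW.
  by move: h2 (normr_ge0 (y - x)); rewrite /c /gap; lra.
have -> : psi y = (fine (psi y))%:E by rewrite fineK ?(psi_regular_fin psi_reg).
rewrite -(fineK (phi_fin phi_reg (psi_ge0 y))) lee_fin.
have hs := hK y x psiy psix; rewrite -/t in hs.
have h3 : `|fine (psi y) - t| < delta.
  by apply: le_lt_trans h1; apply: le_trans hs _; rewrite mulrC ler_wpM2l// lerDl.
have := hdelta _ (psi_ge0 y) h3; rewrite ler_norml -/la => /andP[h4 _].
have h5 : e / (K + 1) * `|fine (psi y) - t| <= e * `|y - x|.
  apply: (@le_trans _ _ (e / (K + 1) * ((K + 1) * `|y - x|))).
    rewrite (ler_pM2l e'0); apply: le_trans hs _.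
    by rewrite ler_wpM2r// lerDl.
  by rewrite mulrA divfK// gt_eqF.
have : la * inner w (y - x) <= la * (fine (psi y) - t).
  by rewrite ler_pM2l//; have := hw y psiy; rewrite -/t; lra.
by rewrite innerZl; lra.
Qed.

End Composition.

(** * Continuity and subgradients of the objective *)

Section Objective.
Context {R : realType} {L : nat} {V : 'I_L -> euclideanType R}.
Local Notation H := (hsum V).
Variables (f : H -> R) (psi : forall l, V l -> \bar R).
Variable phi : 'I_L -> \bar R -> \bar R.
Arguments psi : clear implicits.
Hypotheses (psi_reg : forall l, psi_regular (psi l)).
Hypotheses (phi_reg : forall l, phi_regular (phi l)).

(** Stronger than finiteness of the objective, since [phi l] may be finite at [+oo]. *)
Definition in_dom (x : H) := forall l, (psi l (x l) < +oo)%E.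

Definition Psi_real (x : H) : R := f x + \sum_l fine (phi l (psi l (x l))).

Lemma phi_psi_fin x l : in_dom x -> phi l (psi l (x l)) \is a fin_num.
Proof.
move=> /(_ l) xl; have xf := psi_regular_fin (psi_reg l) xl.
rewrite -(fineK xf); apply: phi_fin => //.
by case: (psi_reg l) => h _ _ _ _; rewrite fine_ge0.
Qed.

Lemma Psifun_fin x : in_dom x -> Psifun f psi phi x = (Psi_real x)%:E.
Proof.
move=> xd; rewrite /Psifun /gfun EFinD -sumEFin; congr (_ + _)%E.
by apply: eq_bigr => l _; rewrite fineK// phi_psi_fin.
Qed.

Lemma near_blocks (x : H) (P : forall l, set (V l)) :
  (forall l, \forall z \near x l, P l z) -> \forall y \near x, forall l, P l (y l).
Proof.
move=> hP; apply: (@filter_forall H 'I_L (fun l y => P l (y l)) (nbhs x)) => l.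
have /nbhs_normP[e /= e0 he] := hP l; apply/nbhs_normP; exists e => // y /= xy.
by apply: he => /=; apply: le_lt_trans xy; exact: (block_norm_le (x - y) l).
Qed.

Lemma Psi_real_continuous x (e : R) : in_dom x -> differentiable f x -> 0 < e ->
  \forall y \near x, in_dom y -> `|Psi_real y - Psi_real x| < e.
Proof.
move=> xd df e0; pose e' := e / (L.+1)%:R.
have e'0 : 0 < e' by rewrite divr_gt0.
have fc := differentiable_continuous df.
have h1 : \forall y \near x, `|f x - f y| < e'.
  by move/cvgrPdist_lt : fc => /(_ _ e'0).
have h2 : \forall y \near x, forall l, (psi l (y l) < +oo)%E ->
    `|fine (phi l (psi l (y l))) - fine (phi l (psi l (x l)))| < e'.
  pose Q l z := (psi l z < +oo)%E ->
    `|fine (phi l (psi l z)) - fine (phi l (psi l (x l)))| < e'.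
  by apply: (@near_blocks x Q) => l; exact: comp_continuous.
apply: filterS2 h1 h2 => y h1 h2 yd.
have -> : e = e' + \sum_(l < L) e'.
  by rewrite sumr_const card_ord -mulrS -mulr_natr divfK.
have -> : Psi_real y - Psi_real x = (f y - f x) +
    \sum_l (fine (phi l (psi l (y l))) - fine (phi l (psi l (x l)))).
  by rewrite sumrB /Psi_real; ring.
apply: le_lt_trans (ler_normD _ _) _; rewrite distrC; apply: ltr_leD => //.
apply: le_trans (ler_norm_sum _ _ _) _; apply: ler_sum => l _.
exact/ltW/h2.
Qed.

(** Sum rule: [f] is differentiable and the rest is separable, so the subgradients of the blocks can
    be chosen independently. *)
Lemma frechet_Psifun x (w : H) : in_dom x -> differentiable f x ->
  (forall l, convex_subgrad (psi l) (x l) (w l)) ->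
  frechet_subdiff (Psifun f psi phi) x
    (fun l => grad f x l + lambda psi phi x l *: w l).
Proof.
move=> xd df hw; split=> [|e e0]; first by rewrite Psifun_fin.
(* Half of the error goes to [f]; the [L] blocks share the other half. *)
pose e' := e / 2 / L.+1%:R.
have e'0 : 0 < e' by rewrite !divr_gt0.
have e20 : 0 < e / 2 by rewrite divr_gt0.
have h1 := grad_expansion df e20.
have h2 : \forall y \near x, forall l, ((fine (phi l (psi l (x l))) +
     (inner (lambda psi phi x l *: w l) (y l - x l) - e' * `|y l - x l|))%:E
     <= phi l (psi l (y l)))%E.
  pose Q l z := ((fine (phi l (psi l (x l))) +
     (inner (lambda psi phi x l *: w l) (z - x l) - e' * `|z - x l|))%:E
     <= phi l (psi l z))%E.
  by apply: (@near_blocks x Q) => l; exact: frechet_comp.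
apply: filterS2 h1 h2 => y h1 h2.
rewrite Psifun_fin// -EFinD.
apply: (@le_trans _ _ ((f x + inner (grad f x) (y - x) - e / 2 * `|y - x|)%:E +
  \sum_l (fine (phi l (psi l (x l))) +
     (inner (lambda psi phi x l *: w l) (y l - x l) - e' * `|y l - x l|))%:E)%E).
  rewrite sumEFin -EFinD lee_fin !big_split/= sumrN /Psi_real.
  have -> : inner ((fun l => grad f x l + lambda psi phi x l *: w l) : H) (y - x) =
      inner (grad f x) (y - x) +
      \sum_l inner (lambda psi phi x l *: w l) (y l - x l).
    rewrite !hsum_innerE -big_split/=; apply: eq_bigr => l _.
    by rewrite innerDl.
  have : \sum_l e' * `|y l - x l| <= e / 2 * `|y - x|.
    apply: (@le_trans _ _ (\sum_(l < L) e' * `|y - x|)).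
      apply: ler_sum => l _; rewrite ler_pM2l//.
      exact: (block_norm_le (y - x) l).
    rewrite -mulr_suml sumr_const card_ord ler_wpM2r//.
    have -> : e / 2 = e' * L.+1%:R by rewrite divfK.
    by rewrite -(mulr_natr e' L) ler_pM2l// ler_nat.
  by lra.
apply: leeD; last exact: lee_sum.
by rewrite lee_fin; move: h1; rewrite ler_norml => /andP[]; lra.
Qed.

End Objective.

(** * The algorithm *)

Section Run.
Context {R : realType} {L : nat} {V : 'I_L -> euclideanType R}.
Local Notation H := (hsum V).
Variables (f : H -> R) (psi : forall l, V l -> \bar R).
Variable phi : 'I_L -> \bar R -> \bar R.
Arguments psi : clear implicits.
Hypothesis f_C1 : C1 f.
Hypothesis f_lip : block_lipschitz_grad f.
Hypothesis psi_reg : forall l, psi_regular (psi l).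
Hypothesis phi_reg : forall l, phi_regular (phi l).
Variables (eta mu : R).
Hypotheses (eta_gt0 : 0 < eta) (mu_gt0 : 0 < mu).
Variables (N : nat -> nat) (J : nat -> nat -> {set 'I_L}).
Variables (alpha : nat -> nat -> R) (x : nat -> H) (xt v : nat -> nat -> H).
Hypothesis run : CO_NEW_BC_FB f psi phi eta mu N J alpha x xt v.
Hypothesis J_cover : forall k, (\bigcup_(i < N k) J k i)%SET = [set: 'I_L]%SET.
Variable Nbar : nat.
Hypotheses (Nbar_gt0 : (0 < Nbar)%N) (N_bound : forall k, (0 < N k <= Nbar)%N).
Variable M : R.
Hypothesis iter_bounded : forall k,
  `|x k| <= M /\ forall i, (i <= N k)%N -> `|xt k i| <= M.

Local Notation Psi := (Psifun f psi phi).
Local Notation F := (Psi_real f psi phi).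
Local Notation lam k l := (lambda psi phi (x k) l).

Definition path_length k : R := \sum_(i < N k) `|xt k i.+1 - xt k i|.
Local Notation D := path_length.

Lemma path_length_ge0 k : 0 <= D k.
Proof. exact: sumr_ge0. Qed.

(** An updated block carries a limiting subgradient, which presupposes a finite value of [psi l];
    the other blocks inherit finiteness from the previous iterate. *)
Lemma inner_in_dom k i : (i <= N k)%N -> in_dom psi (xt k i).
Proof.
have inner m : in_dom psi (xt m 0%N) ->
    forall j, (j <= N m)%N -> in_dom psi (xt m j).
  move=> d0; elim=> [//|j ih jN l]; have st := run_step run jN.
  have [lJ|lJ] := boolP (l \in J m j); last by rewrite (step_fixed st lJ) ih// ltnW.
  by have [w [hw _] _] := step_subgrad st lJ; rewrite ltey_eq hw.
elim: k i => [|k ihk] i; apply: inner => l.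
  by rewrite (run_start run); case: (run_init run).
by rewrite (run_start run) (run_next run); exact: ihk.
Qed.

Lemma outer_in_dom k : in_dom psi (x k).
Proof. by rewrite -(run_start run); exact: inner_in_dom. Qed.

Let psi_ge0 l y : 0 <= fine (psi l y).
Proof. by case: (psi_reg l) => h _ _ _ _; rewrite fine_ge0. Qed.

Let psiE l y : (psi l y < +oo)%E -> psi l y = (fine (psi l y))%:E.
Proof. by move=> h; rewrite fineK// psi_regular_fin. Qed.

Definition majorant_real k (z : H) : R := f z + \sum_l
  (fine (phi l (psi l (x k l))) + lam k l * (fine (psi l (z l)) - fine (psi l (x k l)))).

Lemma majorant_fin k z : in_dom psi z ->
  majorant f psi phi (x k) z = (majorant_real k z)%:E.
Proof.
move=> zd; rewrite /majorant /majorant_real EFinD -sumEFin; congr (_ + _)%E.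
apply: eq_bigr => l _; rewrite EFinD EFinM EFinB -!psiE//; last exact: outer_in_dom.
by rewrite fineK// (phi_psi_fin psi_reg phi_reg l (outer_in_dom k)).
Qed.

Lemma majorant_real_self k : majorant_real k (x k) = F (x k).
Proof.
congr (_ + _); apply: eq_bigr => l _.
by rewrite subrr mulr0 addr0.
Qed.

Lemma majorant_real_ge k z : in_dom psi z -> F z <= majorant_real k z.
Proof.
move=> zd; rewrite lerD2l; apply: ler_sum => l _.
have := phi_tangent (phi_reg l) (psi_ge0 (z l)) (psi_ge0 (x k l)).
by rewrite -!psiE//; exact: outer_in_dom.
Qed.

Lemma outer_descent k : F (x k.+1) + eta / Nbar%:R * D k ^+ 2 <= F (x k).
Proof.
have main i : (i <= N k)%N -> majorant_real k (xt k i) +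
    eta * \sum_(j < i) `|xt k j.+1 - xt k j| ^+ 2 <= F (x k).
  elim: i => [_|i ih iN].
    by rewrite big_ord0 mulr0 addr0 (run_start run) majorant_real_self.
  have := step_descent (run_step run iN).
  rewrite (majorant_fin k (inner_in_dom iN)).
  rewrite (majorant_fin k (inner_in_dom (ltnW iN))).
  rewrite -EFinD lee_fin big_ord_recr/= mulrDr.
  by have := ih (ltnW iN); lra.
have := main (N k) (leqnn _); rewrite -(run_next run).
have := majorant_real_ge k (outer_in_dom k.+1).
have Nb0 : (0 : R) < Nbar%:R by rewrite ltr0n.
(* The square of a sum of [N k] terms is at most [N k <= Nbar] times the sum of their squares. *)
have : eta / Nbar%:R * D k ^+ 2 <= eta * \sum_(j < N k) `|xt k j.+1 - xt k j| ^+ 2.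
  rewrite -mulrA ler_pM2l// mulrC ler_pdivrMr//.
  apply: le_trans (sqr_sum_le _ (fun j => `|xt k j.+1 - xt k j|)) _.
  rewrite mulrC ler_wpM2l ?ler_nat//; last by case/andP: (N_bound k).
  by apply: sumr_ge0 => j _; exact: sqr_ge0.
lra.
Qed.

Lemma outer_step_le k : `|x k.+1 - x k| <= D k.
Proof. by rewrite (run_next run) -(run_start run); exact: norm_telescope. Qed.

(* [j] is the last update of block [l], which stays fixed afterwards. *)
Lemma block_last_update k l : exists2 j, (j < N k)%N & exists2 w,
  convex_subgrad (psi l) (x k.+1 l) w &
  `|grad f (xt k j) l + lam k l *: w| <= mu * (L%:R * `|xt k j.+1 - xt k j|).
Proof.
have main i : (i <= N k)%N -> (exists2 j, (j < i)%N & l \in J k j) ->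
    exists2 j, (j < i)%N & exists2 w, convex_subgrad (psi l) (xt k i l) w &
      `|grad f (xt k j) l + lam k l *: w| <= mu * (L%:R * `|xt k j.+1 - xt k j|).
  elim: i => [_ [j]//|i ih iN [j]]; rewrite ltnS => ji lj.
  have st := run_step run iN.
  have [li|li] := boolP (l \in J k i).
    exists i => //; have [w hw vw] := step_subgrad st li.
    exists w; first exact: limiting_convex hw.
    rewrite vw; have := step_residual st.
    move=> /(le_trans (block_norm_le _ l)).
    rewrite /block_restr /block_merge li => /le_trans; apply.
    (* The factor [L] comes from bounding each block of the step by the whole step. *)
    rewrite ler_pM2l//; apply: (@le_trans _ _ (\sum_(l' < L) `|xt k i.+1 - xt k i|)).
      rewrite big_mkcond/=; apply: ler_sum => l' _; case: ifP => // _.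
      exact: (block_norm_le (xt k i.+1 - xt k i) l').
    by rewrite sumr_const card_ord mulr_natl.
  have [|j' j'i hw] := ih (ltnW iN).
    exists j => //; rewrite ltn_neqAle ji andbT; apply: contraNneq li => <-//.
  by exists j'; [exact: ltnW|rewrite (step_fixed st li)].
rewrite (run_next run); apply: main => //.
have : l \in (\bigcup_(i < N k) J k i)%SET by rewrite J_cover inE.
by move=> /bigcupP[i _ li]; exists i.
Qed.

(** Confines the arguments of [phi l] to a compact interval, on which its derivative is Lipschitz
    and bounded away from 0. The bound comes from the Lipschitz continuity of [psi l] and the
    boundedness of the iterates. *)
Lemma outer_psi_bounded l : exists2 T : R, 0 <= T &
  forall k, 0 <= fine (psi l (x k l)) <= T.
Proof.
have M0 : 0 <= M by apply: le_trans (iter_bounded 0).1.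
have [Kp Kp0 hKp] := psi_lipschitz (psi_reg l).
exists (fine (psi l (x 0%N l)) + Kp * (M + M)) => [|k].
  by rewrite addr_ge0// mulr_ge0// addr_ge0.
rewrite psi_ge0/= -lerBlDl; apply: le_trans (ler_norm _) _.
apply: le_trans (hKp _ _ (outer_in_dom k l) (outer_in_dom 0 l)) _.
rewrite ler_wpM2l//; apply: le_trans (ler_normB _ _) _.
by rewrite lerD// (le_trans (block_norm_le _ l))//; case: (iter_bounded k);
  case: (iter_bounded 0).
Qed.

Lemma block_residual l : exists2 C : R, 0 <= C & forall k, exists2 w,
  convex_subgrad (psi l) (x k.+1 l) w &
  `|grad f (x k.+1) l + lam k.+1 l *: w| <= C * D k.
Proof.
have M0 : 0 <= M by apply: le_trans (iter_bounded 0).1.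
have [Kg Kg0 hKg] := grad_lipschitz f_lip.
have [Kp Kp0 hKp] := psi_lipschitz (psi_reg l).
have [T T0 xT] := outer_psi_bounded l.
have [c c0 hc] := phi_deriv_bounds (phi_reg l) T0.
have [Kl Kl0 hKl] := phi_deriv_lipschitz (phi_reg l) T0.
(* [W] will bound [|w|]: the numerator bounds the gradient at the inner iterate plus the residual of
   a step of length at most [2 M], and [c] is a lower bound of [lam k l]. *)
pose W := (`|grad f 0 l| + Kg * M + mu * (L%:R * (M + M))) / c.
have W0 : 0 <= W.
  by rewrite divr_ge0 ?(ltW c0)// !addr_ge0// ?mulr_ge0// ?(ltW mu_gt0)// addr_ge0.
exists (Kg + mu * L%:R + Kl * Kp * W) => [|k].
  have mu0 := ltW mu_gt0.
  have h1 : 0 <= mu * L%:R by exact: mulr_ge0.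
  have h2 : 0 <= Kl * Kp * W by apply: mulr_ge0 => //; exact: mulr_ge0.
  by lra.
have [j jN [w hw hres]] := block_last_update k l.
exists w => //.
have [_ hxt] := iter_bounded k.
have step2M : `|xt k j.+1 - xt k j| <= M + M.
  by apply: le_trans (ler_normB _ _) _; rewrite lerD// hxt// ltnW.
have stepD : `|xt k j.+1 - xt k j| <= D k.
  by rewrite /D (bigD1 (Ordinal jN))//= lerDl sumr_ge0.
have wW : `|w| <= W.
  rewrite ler_pdivlMr// mulrC.
  apply: (@le_trans _ _ `|lam k l *: w|).
    rewrite normrZ ler_wpM2r//; apply: le_trans (ler_norm _).
    by apply: hc; exact: xT.
  have -> : lam k l *: w = (grad f (xt k j) l + lam k l *: w) - grad f (xt k j) l.
    by rewrite addrAC subrr add0r.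
  apply: le_trans (ler_normB _ _) _; rewrite addrC; apply: lerD; last first.
    by apply: le_trans hres _; rewrite ler_pM2l// ler_wpM2l.
  have hg : `|grad f (xt k j) l - grad f 0 l| <= Kg * M.
    apply: le_trans (hKg _ _ _) _; rewrite ler_wpM2l// subr0.
    by apply: hxt; exact: ltnW.
  rewrite -[grad f (xt k j) l](subrK (grad f 0 l)) addrC.
  by apply: le_trans (ler_normD _ _) _; rewrite lerD2l.
have D0 := path_length_ge0 k.
(* Variation of the gradient since step [j], residual of step [j], and change of the weight from
   [lam k l] to [lam k.+1 l]. *)
have -> : grad f (x k.+1) l + lam k.+1 l *: w = (grad f (x k.+1) l - grad f (xt k j) l)
    + (grad f (xt k j) l + lam k l *: w) + (lam k.+1 l - lam k l) *: w.
  have split3 (p q r s : V l) : p + s = p - q + (q + r) + (s - r).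
    by rewrite (addrA (p - q)) subrK addrACA subrr addr0.
  by rewrite scalerBl; exact: split3.
have h1 : `|grad f (x k.+1) l - grad f (xt k j) l| <= Kg * D k.
  apply: le_trans (hKg _ _ _) _; rewrite ler_wpM2l// (run_next run).
  by apply: norm_telescope; exact: ltnW.
have h2 : `|grad f (xt k j) l + lam k l *: w| <= mu * L%:R * D k.
  by apply: le_trans hres _; rewrite -mulrA ler_pM2l// ler_wpM2l.
have h3 : `|(lam k.+1 l - lam k l) *: w| <= Kl * Kp * W * D k.
  rewrite normrZ mulrAC; apply: ler_pM => //.
  apply: le_trans (hKl _ _ (xT _) (xT _)) _; rewrite -mulrA ler_wpM2l//.
  apply: le_trans (hKp _ _ (outer_in_dom _ l) (outer_in_dom _ l)) _.
  rewrite ler_wpM2l//; apply: le_trans (outer_step_le k).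
  exact: (block_norm_le (x k.+1 - x k) l).
apply: le_trans (ler_normD _ _) _; rewrite !mulrDl; apply: lerD => //.
by apply: le_trans (ler_normD _ _) _; exact: lerD.
Qed.

(** The vectors [w] obtained for the various blocks, possibly at different inner steps, are glued
    into one subgradient at [x k.+1]. *)
Lemma subgrad_residual : exists2 C : R, 0 <= C & forall k, exists2 u,
  frechet_subdiff Psi (x k.+1) u & `|u| <= C * D k.
Proof.
have /choice[C hC] : forall l, exists C : R, 0 <= C /\ forall k, exists w,
    convex_subgrad (psi l) (x k.+1 l) w /\
    `|grad f (x k.+1) l + lam k.+1 l *: w| <= C * D k.
  move=> l; have [C C0 h] := block_residual l; exists C; split => // k.
  by have [w ? ?] := h k; exists w.
exists (\sum_l C l) => [|k]; first by apply: sumr_ge0 => l _; case: (hC l).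
pose w : H := fun l => sval (cid ((hC l).2 k)).
have hw l : convex_subgrad (psi l) (x k.+1 l) (w l) /\
    `|grad f (x k.+1) l + lam k.+1 l *: w l| <= C l * D k.
  exact: (svalP (cid ((hC l).2 k))).
exists (fun l => grad f (x k.+1) l + lam k.+1 l *: w l).
  apply: frechet_Psifun => //; [exact: outer_in_dom|by case: f_C1|].
  by move=> l; case: (hw l).
apply: le_trans (hsum_norm_le_sum _) _; rewrite mulr_suml; apply: ler_sum => l _.
by case: (hw l).
Qed.

(** Lower semicontinuity keeps the cluster point in the domain, because each [psi l] is bounded
    along the iterates; continuity of the objective relative to the domain then makes the values
    cluster along the same indices. *)
Lemma outer_cluster : exists2 xhat : H, in_dom psi xhat &
  forall (e : R) n, 0 < e ->
  exists2 k, (n <= k)%N & `|x k - xhat| < e /\ `|F (x k) - F xhat| < e.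
Proof.
have [xhat hx] := hsum_cluster (fun k => (iter_bounded k).1).
have xd : in_dom psi xhat.
  move=> l; rewrite ltNge; apply/negP; rewrite leye_eq => /eqP psioo.
  have [T T0 xT] := outer_psi_bounded l.
  have [U /nbhs_normP[e /= e0 he] hU] :
      exists2 U, nbhs (xhat l) U & forall y, U y -> (T%:E < psi l y)%E.
    by case: (psi_reg l) => _ _ _ h _; apply: h; rewrite psioo ltey.
  have [k _ xk] := hx e 0%N e0.
  have : U (x k l).
    apply: he; rewrite /= distrC; apply: le_lt_trans xk.
    exact: (block_norm_le (x k - xhat) l).
  move=> /hU; rewrite psiE; last exact: outer_in_dom.
  by rewrite lte_fin ltNge; case/andP: (xT k) => _ ->.
exists xhat => // e n e0.
have := Psi_real_continuous psi_reg phi_reg xd (f_C1.1 xhat) e0.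
move=> /nbhs_normP[d /= d0 hd].
have m0 : 0 < Num.min d e by rewrite lt_min d0.
have [k nk] := hx _ n m0; rewrite lt_min => /andP[kd ke]; exists k => //; split => //.
by apply: hd; [rewrite /= distrC|exact: outer_in_dom].
Qed.

End Run.

(** * Finite length and criticality of the limit *)

Theorem mainTheorem2 (R : realType) (L : nat) (V : 'I_L -> euclideanType R)
  (f : hsum V -> R) (psi : forall l, V l -> \bar R)
  (phi : 'I_L -> \bar R -> \bar R)
  (f_C1 : C1 f)
  (f_lip : block_lipschitz_grad f)
  (psi_reg : forall l, psi_regular (psi l))
  (phi_reg : forall l, phi_regular (phi l))
  (f_maj : quadratic_majorization f)
  (f_C2 : C2 f)
  (f_hess : hess_bounds f)
  (eta mu : R) (eta_gt0 : 0 < eta) (mu_gt0 : 0 < mu)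
  (N : nat -> nat) (J : nat -> nat -> {set 'I_L}) (alpha : nat -> nat -> R)
  (x : nat -> hsum V) (xt v : nat -> nat -> hsum V)
  (run : CO_NEW_BC_FB f psi phi eta mu N J alpha x xt v)
  (J_cover : forall k, (\bigcup_(i < N k) J k i)%SET = [set: 'I_L]%SET)
  (N_bound : exists2 Nbar : nat, (0 < Nbar)%N & forall k, (0 < N k <= Nbar)%N)
  (Psi_bounded : exists m : R, forall y, (m%:E <= Psifun f psi phi y)%E)
  (iter_bounded : exists M : R, forall k,
    `|x k| <= M /\ forall i, (i <= N k)%N -> `|xt k i| <= M)
  (Psi_KL : forall y, dom_ereal (Psifun f psi phi) y -> KL_at (Psifun f psi phi) y) :
  (\sum_(0 <= k <oo) `|x k.+1 - x k|%:E < +oo)%E /\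
  exists xhat : hsum V, x @ \oo --> xhat /\
    limiting_subdiff (Psifun f psi phi) xhat 0.
Proof.
have [Nbar Nbar0 hN] := N_bound; have [M hM] := iter_bounded.
have dom := outer_in_dom run.
have [xhat xd cl] := outer_cluster f_C1 psi_reg phi_reg run hM.
have [C C0 hC] := subgrad_residual f_C1 f_lip psi_reg phi_reg mu_gt0 run J_cover hM.
have PsiE y : in_dom psi y -> Psifun f psi phi y = (Psi_real f psi phi y)%:E.
  exact: Psifun_fin.
have KLx : KL_at (Psifun f psi phi) xhat.
  by apply: Psi_KL; rewrite /dom_ereal/= PsiE// ltry.
have [rho [r [w [rho0 r0 w0 wc kl]]]] := KL_desingularize (PsiE _ xd) KLx.
have a0 : 0 < eta / Nbar%:R by rewrite divr_gt0// ltr0n.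
have [|[B hB] Dcvg xcvg] := kl_finite_length a0 C0 rho0 r0 (path_length_ge0 N xt)
  (outer_step_le run) (outer_descent psi_reg phi_reg eta_gt0 run Nbar0 hN) cl w0 wc.
  move=> k xk F0 Fr s hs; have [u hu uC] := hC k.
  by apply: (kl (x k.+1) u) => //; [exact: PsiE|exact: frechet_limiting].
split.
  (* The partial sums of the outer steps are dominated by those of the path lengths, hence by
     [B]. *)
  apply: (@le_lt_trans _ _ B%:E); last exact: ltry.
  apply: lime_le; first by apply: is_cvg_nneseries => n _ _; rewrite lee_fin.
  apply: nearW => n; rewrite sumEFin lee_fin big_mkord.
  apply: le_trans (hB n); apply: ler_sum => k _; exact: outer_step_le run k.
exists xhat; split => //; split; first by rewrite PsiE.
(* Criticality: the Frechet subgradients [u k] at [x k.+1] tend to 0 with the path lengths, so they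
   witness that 0 is a limiting subgradient at [xhat]. *)
have /choice[u hu] : forall k, exists u,
    frechet_subdiff (Psifun f psi phi) (x k.+1) u /\ `|u| <= C * path_length N xt k.
  by move=> k; have [u] := hC k; exists u.
have xScvg : x n.+1 @[n --> \oo] --> xhat by rewrite (cvg_shiftS x).
exists (fun n => x n.+1), u; split => //.
- rewrite (_ : _ \o _ = EFin \o (fun n => Psi_real f psi phi (x n.+1))); last first.
    by apply/funext => n; exact: PsiE.
  rewrite PsiE//; apply: cvg_EFin; first exact: nearW.
  apply/cvgrPdist_lt => e e0.
  have := Psi_real_continuous psi_reg phi_reg xd (f_C1.1 xhat) e0.
  move=> /xScvg h.
  have {}h : \forall n \near \oo, in_dom psi (x n.+1) ->
    `|Psi_real f psi phi (x n.+1) - Psi_real f psi phi xhat| < e by exact: h.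
  apply: filterS h => n h; rewrite distrC; apply: h; exact: dom.
- by move=> n; case: (hu n).
- apply/cvgr0Pnorm_le => e e0.
  have e'0 : 0 < e / (C + 1) by rewrite divr_gt0// ltr_wpDl.
  move/cvgr0Pnorm_le : Dcvg => /(_ _ e'0); apply: filterS => n.
  rewrite ger0_norm ?path_length_ge0// ler_pdivlMr ?ltr_wpDl// => h.
  apply: le_trans (hu n).2 _; have := path_length_ge0 N xt n; lra.
Qed.
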